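(* There exists a real sequence $\Lambda=\{\lambda(n)\}_{n\in\mathbf{Z}}$ with $\lambda(n)=n+o(1)$ as $|n|\to\infty$ such that for every measurable function $f:\mathbf{R}\to\mathbf{C}$ there exist complex coefficients $\{c_n\}_{n\in\mathbf{Z}}$ with $$f(x)=\sum_{n\in\mathbf{Z}}c_n e^{i\lambda(n)x}\quad\text{for almost every }x\in\mathbf{R},$$ where the series converges for almost every $x\in\mathbf{R}$ in the sense of symmetric partial sums, i.e. $\lim_{\eta\to\infty}\sum_{|\lambda(n)|<\eta}c_n e^{i\lambda(n)x}=f(x)$ for almost every $x\in\mathbf{R}$. Moreover, for every pre-given real sequence $\{\rho(k)\}_{k\in\mathbf{N}}$ with $\rho(k)\neq 0$ for all $k$ and $\rho(k)\to 0$ as $k\to\infty$, such a sequence $\Lambda$ can be chosen so that the perturbations $\alpha(n)=\lambda(n)-n$, $n\in\mathbf{Z}$, are obtained from $\{\rho(k)\}_{k\in\mathbf{N}}$ by rearrangement with finite repetitions.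
   Context: Measurable and almost everywhere refer to Lebesgue measure on $\mathbf{R}$. The sequence $\Lambda$ does not depend on $f$; the coefficients $c_n$ do. Convergence of a series $\sum_{n\in\mathbf{Z}}c_n e^{i\lambda(n)x}$ is understood with respect to the symmetric partial sums $\sum_{|\lambda(n)|<\eta}c_n e^{i\lambda(n)x}$, $\eta>0$, as $\eta\to\infty$. Each such partial sum is finite because $\lambda(n)=n+o(1)$. A sequence $\{\alpha(n)\}_{n\in\mathbf{Z}}$ is obtained from $\{\rho(k)\}_{k\in\mathbf{N}}$ by rearrangement with finite repetitions if there is a surjective map $\kappa:\mathbf{Z}\to\mathbf{N}$ such that $\kappa^{-1}(k)$ is finite for every $k\in\mathbf{N}$ and $\alpha(n)=\rho(\kappa(n))$ for all $n\in\mathbf{Z}$; that is, every term $\rho(k)$ is used at least once and only finitely many times. *)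

(* Defs.v *)
From HB Require Import structures.
From mathcomp Require Import all_boot all_order all_algebra.
From mathcomp Require Import all_classical all_reals all_analysis.
From mathcomp Require Import complex.

Set Implicit Arguments.
Unset Strict Implicit.
Unset Printing Implicit Defensive.

Import Order.TTheory GRing.Theory Num.Theory.
Import numFieldNormedType.Exports.

Local Open Scope classical_set_scope.
Local Open Scope ring_scope.
Local Open Scope complex_scope.

(* The real line with the Lebesgue (i.e. completed Borel) sigma-algebra, the
   domain of [completed_lebesgue_measure]; the type [measurableTypeR R] on
   which [lebesgue_measure] is defined only carries the Borel sigma-algebra. *)
Definition lebesgueType (R : realType) :=
  caratheodory_type (@wlength R idfun)^*%mu.

(* The regular module R[i]^o is what carries the topology of the complex
   modulus: R[i] itself has no canonical topology. *)
Definition borelC (R : realType) := g_sigma_algebraType (@open R[i]^o).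

Definition lebesgue_measurable (R : realType) (f : R -> R[i]) : Prop :=
  measurable_fun [set: lebesgueType R] (f : lebesgueType R -> borelC R).

Definition expi (R : realType) (t : R) : R[i] := cos t +i* sin t.

(* The finitely supported sum [\sum_(n \in A)] is 0 when infinitely many terms
   are nonzero; under [asymp_int lam] the index set is finite. *)
Definition symm_partial_sum (R : realType) (lam : int -> R) (c : int -> R[i])
    (x eta : R) : R[i]^o :=
  \sum_(n \in [set n : int | `|lam n| < eta]) c n * expi (lam n * x).

Definition asymp_int (R : realType) (lam : int -> R) : Prop :=
  forall e : R, 0 < e ->
    exists N : nat, forall n : int, (N <= `|n|)%N -> `|lam n - n%:~R| < e.

Definition represents_ae (R : realType) (lam : int -> R) (c : int -> R[i])
    (f : R -> R[i]) : Prop :=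
  {ae @lebesgue_measure R, forall x : R,
    symm_partial_sum lam c x eta @[eta --> +oo] --> (f x : R[i]^o)}.

Definition universal_spectrum (R : realType) (lam : int -> R) : Prop :=
  forall f : R -> R[i], lebesgue_measurable f ->
    exists c : int -> R[i], represents_ae lam c f.

Definition finite_repetition_rearrangement (T : Type) (alpha : int -> T)
    (rho : nat -> T) : Prop :=
  exists kappa : int -> nat,
    [/\ forall k : nat, exists n : int, kappa n = k,
        forall k : nat, finite_set (kappa @^-1` [set k]) &
        forall n : int, alpha n = rho (kappa n)].

(* Main.v *)
Require Import Defs.
From HB Require Import structures.
From mathcomp Require Import all_boot all_order all_algebra.
From mathcomp Require Import all_classical all_reals all_analysis.
From mathcomp Require Import complex.
From mathcomp Require Import ring lra zify.

Set Implicit Arguments.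
Unset Strict Implicit.
Unset Printing Implicit Defensive.

Import Order.TTheory GRing.Theory Num.Theory.
Import numFieldNormedType.Exports.

Local Open Scope classical_set_scope.
Local Open Scope ring_scope.

(* For a trigonometric sum [g], the product of [g] with [W(Qx)], where
   [W = (1/I) sum_(i < I) (1 - F(n^i x))] and [F] is a Fejer kernel, is close to [g]
   off a small set, while its partial sums are bounded by [C |g|] up to a small
   error: a frequency cluster carries only the weight [1/I], and an incomplete
   Fejer kernel is at most of order [I/d] off a set of measure [d/I].  Here [C]
   depends only on the measure of the exceptional set, not on the precision.
   Multiplying by [W(Qx)] translates frequencies by multiples of [Q], so the
   perturbations [rho k] are kept.  Since [rho] tends to 0 without vanishing, Taylor
   expansion puts every monomial in the closure (in measure) of the exponentials
   [expi (rho k * x)], and polynomials approximate every measurable function.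
   Countably many stages, coding rational polynomials and precisions, determine the
   spectrum; given [f], stages are selected greedily to approximate the successive
   residuals, and the Borel-Cantelli lemma yields convergence almost everywhere. *)

(** Approximation in measure says nothing about partial sums, so the order of summation shapes the
    proof. Stage [s] lives in the shell [N s < |n| < N s.+1]; hence a symmetric partial sum consists
    of complete selected stages and one truncated stage. The complete ones leave a residual of size
    [eps j], and the truncated one is bounded by about [C j.+1] times this residual, so [eps j] has
    to be small compared with [1 / C j.+1]. Since the Fejer kernel has mean 1, [W] has no constant
    term; multiplication by [W(Qx)] with [Q] large therefore moves every frequency beyond any given
    bound. This is what lets the same [rho k] serve again in shells arbitrarily far out, with new
    integer parts only. *)

(** * Statements that hold outside a set of small outer measure *)

Section Mostly.
Context {R : realType}.
Implicit Types (A B : set R) (L d : R) (P : R -> Prop).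

(* [lebesgue_measure] is total on sets, where it is the Lebesgue outer measure. *)
Notation mu := (@lebesgue_measure R).

Lemma lebesgue_le A B : A `<=` B -> (mu A <= mu B)%E.
Proof. exact: (le_outer_measure (wlength idfun)^*%mu). Qed.

Lemma lebesgueU2 A B : (mu (A `|` B) <= mu A + mu B)%E.
Proof. exact: (outer_measureU2 (wlength idfun)^*%mu). Qed.

Lemma lebesgue_bigcup (F : nat -> set R) :
  (mu (\bigcup_n F n) <= \sum_(0 <= n <oo) mu (F n))%E.
Proof. exact: (outer_measure_sigma_subadditive (wlength idfun)^*%mu). Qed.

Lemma lebesgue_bigsetU (F : nat -> set R) n :
  (mu (\big[setU/set0]_(i < n) F i) <= \sum_(i < n) mu (F i))%E.
Proof. exact: (outer_measure_subadditive (wlength idfun)^*%mu). Qed.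

(** The failure set is measured from outside, so [P] may quantify over all truncations of a sum
    without any measurability proof. *)
Definition mostly L d P : Prop :=
  (mu [set x : R | (`|x| <= L)%R /\ ~ P x] <= d%:E)%E.

Lemma mostly_all L d P : 0 <= d -> (forall x, `|x| <= L -> P x) -> mostly L d P.
Proof.
move=> d0 h; rewrite /mostly (_ : [set x | _] = set0); last first.
  by rewrite -subset0 => x [/= xL]; apply; exact: h.
by rewrite measure0 lee_fin.
Qed.

Lemma mostlyS L d P Q : mostly L d P ->
  (forall x, `|x| <= L -> P x -> Q x) -> mostly L d Q.
Proof.
move=> h PQ; apply: le_trans h; apply: lebesgue_le => x [/= xL nQ].
by split => // /PQ; tauto.
Qed.

Lemma mostlyI L d1 d2 P Q : mostly L d1 P -> mostly L d2 Q ->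
  mostly L (d1 + d2) (fun x => P x /\ Q x).
Proof.
move=> hP hQ; rewrite /mostly EFinD.
apply: le_trans (leeD hP hQ); apply: le_trans (lebesgueU2 _ _).
apply: lebesgue_le => x [/= xL /not_andP[nP|nQ]]; [left|right]; by split.
Qed.

Lemma mostly_forall L d (F : nat -> R -> Prop) n :
  (forall i, (i < n)%N -> mostly L d (F i)) -> mostly L (n%:R * d) (fun x => forall i, (i < n)%N -> F i x).
Proof.
elim: n => [|n IH] h; first by apply: mostly_all => //; rewrite mul0r.
have h1 := IH (fun i hi => h i (ltnW hi)).
have := mostlyI h1 (h n (ltnSn n)).
rewrite -natr1 mulrDl mul1r => h2; apply: mostlyS h2 _ => x xL [a b] i.
by rewrite ltnS leq_eqVlt => /orP[/eqP ->|/a].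
Qed.

End Mostly.

(** * The set where [sin (m x / 2)] is small *)

Section SineMeasure.
Context {R : realType}.
Implicit Types (x y t : R).

Lemma sin_shift_int y (k : int) : `|sin (y - k%:~R * pi)| = `|sin y|.
Proof.
have key z (n : nat) : `|sin (z + n%:R * pi)| = `|sin z|.
  elim: n => [|n IH]; first by rewrite mul0r addr0.
  by rewrite -natr1 mulrDl mul1r addrA sinDpi normrN.
case: k => n; last rewrite NegzE.
  by rewrite -[in RHS](subrK (n%:R * pi) y) key.
by rewrite intrN mulNr opprK key.
Qed.

Lemma sin_le_id t : 0 <= t -> sin t <= t.
Proof.
move=> t0; have [|c _] := @MVT_segment R sin cos 0 t t0 (fun x _ => is_derive_sin x).
- exact: continuous_subspaceT (@continuous_sin R).
- by rewrite sin0 !subr0 => ->; have := cos_le1 c; nra.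
Qed.

Lemma cos_ge_quad t : 0 <= t -> 1 - t ^+ 2 <= cos t.
Proof.
move=> t0; have [|c] := @MVT_segment R cos (fun x => - sin x) 0 t t0 (fun x _ => is_derive_cos x).
- exact: continuous_subspaceT (@continuous_cos R).
- rewrite in_itv/= => /andP[c0 ct]; rewrite cos0 subr0 => h.
  have := sin_le_id c0; nra.
Qed.

(** Up to [1 / 2] the mean value theorem with [cos c >= 1 - c ^+ 2] gives [t <= 2 * sin t]; beyond,
    [sin t >= sin (1 / 2) >= 1 / 4] while [t < 2]. This is the origin of the 8. *)
Lemma sin_ge_lin t : 0 <= t <= pi / 2 -> t <= 8 * sin t.
Proof.
move=> /andP[t0 tpi].
have small (u : R) : 0 <= u <= 1 / 2 -> u <= 2 * sin u.
  move=> /andP[u0 u1]; have [|c] := @MVT_segment R sin cos 0 u u0 (fun x _ => is_derive_sin x).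
  - exact: continuous_subspaceT (@continuous_sin R).
  - rewrite in_itv/= => /andP[c0 cu]; rewrite sin0 !subr0 => ->.
    have := cos_ge_quad c0; nra.
have [th|th] := leP t (1 / 2); first by have := small t; rewrite t0 th => /(_ isT); nra.
have p2 := @pihalf_lt2 R.
have h12 : sin (1 / 2) <= sin t.
  have p1 := @pihalf_ge1 R.
  by apply: ltW; rewrite ltr_sin ?in_itv//=; apply/andP; split; lra.
have := small (1 / 2); lra.
Qed.

Lemma sin_norm_ge_lin t : `|t| <= pi / 2 -> `|t| <= 8 * `|sin t|.
Proof.
wlog t0 : t / 0 <= t.
  move=> h; have [/h//|/ltW t0] := leP 0 t.
  by have := h (- t); rewrite sinN !normrN oppr_ge0; exact.
rewrite ger0_norm// => tp; apply: le_trans (sin_ge_lin _) _; first by rewrite t0.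
by rewrite ler_pM2l// ler_norm.
Qed.

(** A bad point lies within [16 * r / m] of a zero [2 k pi / m] of the sine, and at most
    [2 * m * A + 1] zeros matter on [[-L, L]]. The factors [m] cancel, so the bound is uniform in
    the frequency. *)
Let mostly_sin_ge_nat (L : R) (A m : nat) (r : R) : 0 <= r -> L + 1 <= A%:R -> (0 < m)%N ->
  mostly L (96 * A%:R * r) (fun x => r <= `|sin (m%:R * x / 2)|).
Proof.
move=> r0 LA m0.
have [L0|L0] := ltP L 0.
  apply: mostly_all => [|x xL]; first by rewrite !mulr_ge0.
  by have := le_trans (normr_ge0 x) xL; rewrite leNgt L0.
have A0 : 1 <= A%:R :> R by lra.
have mR : 1 <= m%:R :> R by rewrite ler1n.
pose M := (m * A)%N.
pose c (j : nat) : R := (j%:R - M%:R) * (2 * pi / m%:R).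
pose F j := ball (c j) (16 * r / m%:R).
apply: (@le_trans _ _ (@lebesgue_measure R (\big[setU/set0]_(j < M.*2.+1) F j))).
  apply: lebesgue_le => x [/= xL /negP]; rewrite -ltNge => hx.
  pose y := m%:R * x / 2.
  pose k := Num.floor (y / pi + 1 / 2).
  have pi0 := @pi_gt0 R; have p2 := @pi_ge2 R.
  have := Num.Theory.floor_itv (y / pi + 1 / 2); rewrite -/k => /andP[k1 k2].
  have yk1 : k%:~R * pi - pi / 2 <= y.
    by move: k1; rewrite -lerBlDr ler_pdivlMr//; lra.
  have yk2 : y <= k%:~R * pi + pi / 2.
    by move: k2; rewrite intrD -ltrBrDr ltr_pdivrMr//; lra.
  have /sin_norm_ge_lin : `|y - k%:~R * pi| <= pi / 2 by rewrite ler_norml; lra.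
  rewrite sin_shift_int => yk.
  have {}yk : `|y - k%:~R * pi| < 8 * r by rewrite (le_lt_trans yk)// ltr_pM2l.
  have yM : `|y| <= m%:R * L / 2.
    rewrite /y normrM normrM ger0_norm// [`|2^-1|]ger0_norm//.
    by rewrite ler_pM2r// ler_pM2l//; lra.
  have kM : `|k%:~R| <= M%:R :> R.
    rewrite /M natrM ler_norml; move: yM; rewrite ler_norml => /andP[y1 y2].
    have z0 : 0 <= m%:R * L by rewrite mulr_ge0.
    have z1 : m%:R * (L + 1) <= m%:R * A%:R by rewrite ler_wpM2l.
    have z2 : 0 <= m%:R * L * (pi - 2) by rewrite mulr_ge0// subr_ge0.
    have z3 : 0 <= (m%:R - 1) * pi :> R by rewrite mulr_ge0 ?subr_ge0 ?pi_ge0.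
    have z4 : m%:R * (L + 1) * pi <= m%:R * A%:R * pi by rewrite ler_pM2r.
    by apply/andP; split; rewrite -(ler_pM2r pi0); lra.
  have : (`|k| <= M)%N.
    by rewrite -(ler_nat R) natr_absz intr_norm.
  move=> kMn.
  have [j jM jk] : exists2 j, (j < M.*2.+1)%N & j%:R - M%:R = k%:~R :> R.
    have kM0 : 0 <= k + M%:Z by move: kMn; clear; lia.
    exists (absz (k + M%:Z)); first by move: kMn; clear; lia.
    by rewrite natr_absz ger0_norm// intrD addrK.
  rewrite -bigcup_mkord; exists j => //.
  rewrite /F /ball/= /c jk.
  rewrite (_ : _ - x = - (2 / m%:R * (y - k%:~R * pi))); last first.
    by rewrite /y; field; rewrite gt_eqF//; lra.
  rewrite normrN normrM ger0_norm; last by rewrite divr_ge0.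
  by rewrite mulrAC ltr_pM2r ?invr_gt0; lra.
apply: le_trans (lebesgue_bigsetU _ _) _.
rewrite (eq_bigr (fun=> (16 * r / m%:R *+ 2)%:E)); last first.
  by move=> j _; rewrite lebesgue_measure_ball// divr_ge0// mulr_ge0.
rewrite sumEFin lee_fin sumr_const card_ord -mulrnA -[leLHS]mulr_natr.
have h1 : 1 <= m%:R * A%:R :> R by rewrite (le_trans mR)// ler_peMr// ler0n.
have h2 : (2 * M.*2.+1)%N%:R <= 6 * (m%:R * A%:R) :> R.
  by rewrite natrM -(addn1 M.*2) -muln2 natrD /M !natrM; lra.
apply: (@le_trans _ _ (16 * r / m%:R * (6 * (m%:R * A%:R)))).
  by rewrite ler_wpM2l// divr_ge0// mulr_ge0.
by rewrite le_eqVlt; apply/orP; left; apply/eqP; field; rewrite gt_eqF//; lra.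
Qed.

Lemma mostly_sin_ge (L : R) : exists2 c : R, 1 <= c &
  forall (m : nat) (r : R), 0 <= r -> (0 < m)%N ->
    mostly L (c * r) (fun x => r <= `|sin (m%:R * x / 2)|).
Proof.
pose A := (Num.bound (L + 1)).+1.
exists (96 * A%:R) => [|m r r0 m0].
  by rewrite -natrM ler1n.
by apply: mostly_sin_ge_nat => //; rewrite ltW// (lt_trans (unstable.ltr_bound _))// ltr_nat.
Qed.

End SineMeasure.

(** * Complete and truncated Fejer kernels *)

Section CosineKernel.
Context {R : realType}.
Implicit Types (y : R) (n K k : nat).

(** The sum of [e^(iky)] over [|k| < K]. *)
Definition dirichlet y K : R :=
  \sum_(k < K) (if k == 0 :> nat then 1 else 2 * cos (k%:R * y)).

Lemma dirichletS y K :
  dirichlet y K.+1 = dirichlet y K + (if K == 0 then 1 else 2 * cos (K%:R * y)).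
Proof. by rewrite /dirichlet big_ord_recr. Qed.

Lemma sin_dirichlet y K : sin (y / 2) * dirichlet y K.+1 = sin ((K%:R + 1 / 2) * y).
Proof.
elim: K => [|K IH].
  rewrite dirichletS /dirichlet big_ord0 eqxx add0r mulr1 add0r.
  by congr sin; rewrite mulrC mul1r.
rewrite dirichletS mulrDr IH /=.
have -> : (K%:R + 1 / 2) * y = K.+1%:R * y - y / 2 by rewrite -[K.+1%:R]natr1; field.
have -> : (K.+1%:R + 1 / 2) * y = K.+1%:R * y + y / 2 by field.
by rewrite sinB sinD; ring.
Qed.

Lemma sin_dirichlet_le y K : `|sin (y / 2) * dirichlet y K| <= 1.
Proof.
case: K => [|K]; first by rewrite /dirichlet big_ord0 mulr0 normr0.
by rewrite sin_dirichlet sin_max.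
Qed.

Lemma sin2_sum_dirichlet y n :
  sin (y / 2) ^+ 2 * \sum_(j < n) dirichlet y j.+1 = (1 - cos (n%:R * y)) / 2.
Proof.
elim: n => [|n IH]; first by rewrite big_ord0 mul0r cos0 subrr mul0r mulr0.
rewrite big_ord_recr /= mulrDr IH expr2 -mulrA sin_dirichlet.
have -> : (n%:R + 1 / 2) * y = n%:R * y + y / 2 by field.
have -> : n.+1%:R * y = (n%:R * y + y / 2) + y / 2 by rewrite -[n.+1%:R]natr1; field.
rewrite [cos (n%:R * y + y / 2 + _)]cosD.
have -> : cos (n%:R * y) = cos ((n%:R * y + y / 2) - y / 2) by rewrite addrK.
by rewrite cosB; lra.
Qed.

(** This is [n] times the Fejer kernel of order [n], truncated to the frequencies [|k| < K]; it is
    complete for [K = n]. *)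
Definition fejer n y K : R :=
  \sum_(k < K) (n%:R - k%:R) * (if k == 0 :> nat then 1 else 2 * cos (k%:R * y)).

Lemma fejer_abel n y K :
  fejer n y K = (n%:R - K%:R) * dirichlet y K + \sum_(j < K) dirichlet y j.+1.
Proof.
elim: K => [|K IH]; first by rewrite /fejer /dirichlet !big_ord0 mulr0 addr0.
rewrite /fejer big_ord_recr /= -/(fejer n y K) IH dirichletS.
rewrite [in RHS]big_ord_recr /= dirichletS -[K.+1%:R]natr1.
by move: (\sum_(_ < _) _) (dirichlet y K) (if _ then _ else _) => s u c; ring.
Qed.

(** By [fejer_abel] a truncation is a combination of Dirichlet kernels with nonnegative weights of
    total mass [n]. *)
Lemma sin_fejer_le n y K : (K <= n)%N -> `|sin (y / 2) * fejer n y K| <= n%:R.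
Proof.
move=> Kn; rewrite fejer_abel mulrDr.
have Kn0 : 0 <= n%:R - K%:R :> R by rewrite subr_ge0 ler_nat.
have -> : n%:R = (n%:R - K%:R) + K%:R :> R by rewrite subrK.
apply: le_trans (ler_normD _ _) _; apply: lerD.
  rewrite addrK mulrCA normrM (ger0_norm Kn0) ler_piMr//.
  exact: sin_dirichlet_le.
rewrite mulr_sumr; apply: le_trans (ler_norm_sum _ _ _) _.
rewrite -[X in _ <= X%:R]card_ord -sumr_const.
by apply: ler_sum => j _; exact: sin_dirichlet_le.
Qed.

(** In the complete kernel the boundary term of the Abel summation drops out; away from the peak
    this gains a factor [n] over a truncation. *)
Lemma sin2_fejer n y : `|sin (y / 2) ^+ 2 * fejer n y n| <= 1.
Proof.
rewrite fejer_abel subrr mul0r add0r sin2_sum_dirichlet.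
have := cos_le1 (n%:R * y); have := cos_geN1 (n%:R * y).
by rewrite ler_norml => h1 h2; apply/andP; split; lra.
Qed.

(* The coefficients of [1 - F], with [F] the Fejer kernel of order [n]. *)
Definition cofejer_coef n k : R :=
  if (0 < k < n)%N then - (1 - k%:R / n%:R) else 0.

Definition cofejer n y K : R :=
  \sum_(k < K) cofejer_coef n k * (2 * cos (k%:R * y)).

Lemma norm_cofejer_coef n k : `|cofejer_coef n k| <= 1.
Proof.
rewrite /cofejer_coef; case: ifP; last by rewrite normr0.
move=> /andP[k0 kn]; rewrite normrN ger0_norm.
  by rewrite gerBl divr_ge0.
by rewrite subr_ge0 ler_pdivrMr ?mul1r ?ler_nat ?ltr0n ?(ltnW kn) ?(leq_trans _ kn).
Qed.

Lemma cofejerE n y K : (0 < K <= n)%N -> cofejer n y K = 1 - fejer n y K / n%:R.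
Proof.
case: K => // K /= Kn; have n0 : n%:R != 0 :> R by rewrite pnatr_eq0; case: n Kn.
elim: K Kn => [|K IH] Kn.
  rewrite /cofejer /fejer !big_ord_recl !big_ord0 /= /cofejer_coef /=.
  by rewrite mul0r mulr1 subr0 !addr0 divff// subrr.
rewrite /cofejer /fejer !(big_ord_recr K.+1) /= -/(cofejer n y K.+1) -/(fejer n y K.+1).
by rewrite (IH (ltnW Kn)) /cofejer_coef /= Kn; field.
Qed.

Lemma cofejer_stable n y K : (n <= K)%N -> cofejer n y K = cofejer n y n.
Proof.
move=> nK; rewrite /cofejer -(subnKC nK) big_split_ord /= [X in _ + X]big1 ?addr0//.
by move=> i _; rewrite /cofejer_coef [(_ < n)%N]ltnNge leq_addr andbF mul0r.
Qed.

(** The Fejer kernel has mean 1, so [1 - F] has no constant term: a kernel whose frequencies have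
    not been reached contributes nothing. *)
Lemma cofejer_le1 n y K : (K <= 1)%N -> cofejer n y K = 0.
Proof.
case: K => [|[|//]] _; first by rewrite /cofejer big_ord0.
by rewrite /cofejer big_ord_recl big_ord0 /cofejer_coef /= mul0r addr0.
Qed.

Lemma cofejer_full n y K (t : R) : (0 < n <= K)%N -> 0 < t -> t <= `|sin (y / 2)| ->
  `|cofejer n y K - 1| <= (n%:R * t ^+ 2)^-1.
Proof.
move=> /andP[n0 nK] t0 ts; have nR : 0 < n%:R :> R by rewrite ltr0n.
rewrite cofejer_stable// cofejerE ?n0 ?leqnn// addrAC subrr sub0r normrN.
rewrite normrM [`|_^-1|]ger0_norm ?invr_ge0//.
rewrite invfM mulrC ler_pM2l ?invr_gt0//.
rewrite -[leRHS]mul1r ler_pdivlMr ?exprn_gt0//.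
apply: le_trans (sin2_fejer n y); rewrite normrM [leLHS]mulrC normrX.
by rewrite ler_wpM2r// ler_sqr ?nnegrE// ltW.
Qed.

Lemma cofejer_partial n y K (t : R) : (0 < n)%N -> 0 < t <= 1 -> t <= `|sin (y / 2)| ->
  `|cofejer n y K| <= 2 / t.
Proof.
move=> n0 /andP[t0 t1] ts; have nR : 0 < n%:R :> R by rewrite ltr0n.
wlog Kn : K / (K <= n)%N.
  by move=> h; have [/h//|/ltnW nK] := leqP K n; rewrite cofejer_stable// h.
case: K Kn => [|K] Kn; first by rewrite cofejer_le1// normr0 divr_ge0// ltW.
rewrite cofejerE//; apply: le_trans (ler_normB _ _) _.
rewrite normr1 (_ : 2 / t = t^-1 + t^-1); last by lra.
apply: lerD; first by rewrite invf_ge1.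
rewrite normrM [`|_^-1|]ger0_norm ?invr_ge0// ler_pdivrMr//.
rewrite [leRHS]mulrC ler_pdivlMr//.
apply: le_trans (sin_fejer_le y Kn); rewrite normrM [leLHS]mulrC.
by rewrite ler_wpM2r.
Qed.

End CosineKernel.

(** * Averages of Fejer kernels over lacunary scales *)

Section LacunaryKernel.
Context {R : realType}.
Implicit Types (z : R) (n I K q i : nat).

(** [K'] is [K / d] rounded up: truncating a series in [d x] at frequency [K] truncates the series
    in [x] at [K']. *)
Lemma sum_multiples (V : nmodType) (d : nat) (f : nat -> V) K : (0 < d)%N ->
  exists2 K', (K <= d * K' < K + d)%N &
    \sum_(q < K | (d %| q)%N) f (q %/ d)%N = \sum_(k < K') f k.
Proof.
move=> d0; elim: K => [|K [K' hK' IH]].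
  by exists 0%N; rewrite ?muln0 ?big_ord0 ?add0n.
rewrite big_mkcond big_ord_recr /= -big_mkcond IH.
have [/dvdnP[m Km]|ndK] := ifPn; last first.
  rewrite addr0; exists K' => //.
  have : K != (d * K')%N by apply: contraNneq ndK => ->; rewrite dvdn_mulr.
  by move: hK'; lia.
have K'm : K' = m by rewrite Km mulnC in hK'; nia.
by exists m.+1; [rewrite Km; nia|rewrite big_ord_recr /= K'm Km mulnK].
Qed.

(** The coefficient of [e^(iqx)] in [W], where [F] has order [n]. *)
Definition kernel_coef n I q : R :=
  I%:R^-1 * \sum_(i < I) (if (n ^ i %| q)%N then cofejer_coef n (q %/ n ^ i) else 0).

Lemma kernel_coef0 n I : kernel_coef n I 0 = 0.
Proof.
rewrite /kernel_coef big1 ?mulr0// => i _.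
by rewrite dvdn0 div0n /cofejer_coef.
Qed.

Lemma kernel_coef_ge n I q : (1 < n)%N -> (n ^ I <= q)%N -> kernel_coef n I q = 0.
Proof.
move=> n1 nq; rewrite /kernel_coef big1 ?mulr0// => i _.
case: ifP => // _; rewrite /cofejer_coef [(_ < n)%N]ltnNge [(n <= _ %/ _)%N]leq_divRL ?expn_gt0 ?(ltnW n1)//.
by rewrite -expnS (leq_trans _ nq) ?andbF// leq_exp2l.
Qed.

(** The scale [i] only carries frequencies in [[n ^ i, n ^ i.+1[]. These ranges are disjoint, so a
    single scale, [trunc_log n q], can contribute to [q]. *)
Lemma norm_kernel_coef n I q : (1 < n)%N -> `|kernel_coef n I q| <= I%:R^-1.
Proof.
move=> n1; rewrite /kernel_coef normrM ger0_norm ?invr_ge0//.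
rewrite ler_piMr ?invr_ge0//.
have [->|q0] := posnP q.
  rewrite big1 ?normr0// => i _; by rewrite dvdn0 div0n /cofejer_coef.
have zero i : i != trunc_log n q ->
    (if (n ^ i %| q)%N then cofejer_coef n (q %/ n ^ i) else 0) = 0 :> R.
  move=> ii; case: ifP => // dq; rewrite /cofejer_coef.
  case: ifP => // /andP[h1 h2]; case/eqP: ii.
  apply/esym/trunc_log_eq => //; move: h2; rewrite ltn_divLR ?expn_gt0 ?(ltnW n1)//.
  by rewrite -expnS => ->; rewrite dvdn_leq.
have [tI|tI] := ltnP (trunc_log n q) I; last first.
  by rewrite big1 ?normr0// => i _; apply: zero; rewrite ltn_eqF// (leq_trans (ltn_ord i)).
rewrite (bigD1 (Ordinal tI))//= big1 ?addr0.
  by case: ifP => _; [exact: norm_cofejer_coef|rewrite normr0].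
by move=> i iI; apply: zero; apply: contraNneq iI => e; apply/eqP/val_inj.
Qed.

(** The factor 2 at [q = 0] is harmless, since every [W] in question has [W 0 = 0]. *)
Definition kernel_sum (W : nat -> R) z K : R :=
  \sum_(q < K) W q * (2 * cos (q%:R * z)).

Lemma kernel_sumE n I z K : (1 < n)%N -> exists2 k : nat -> nat,
    (forall i, (K <= n ^ i * k i < K + n ^ i)%N) &
    kernel_sum (kernel_coef n I) z K =
      I%:R^-1 * \sum_(i < I) cofejer n ((n ^ i)%:R * z) (k i).
Proof.
move=> n1.
have h i : exists k, (K <= n ^ i * k < K + n ^ i)%N /\
  \sum_(q < K) (if (n ^ i %| q)%N then cofejer_coef n (q %/ n ^ i) else 0) * (2 * cos (q%:R * z))
   = cofejer n ((n ^ i)%:R * z) k.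
  have ni : (0 < n ^ i)%N by rewrite expn_gt0 (ltnW n1).
  have [k hk e] := sum_multiples (fun q => cofejer_coef n q * (2 * cos (q%:R * ((n ^ i)%:R * z)))) K ni.
  exists k; split=> //; rewrite /cofejer -e [RHS]big_mkcond; apply: eq_bigr => q _.
  by case: ifP => [dq|_]; [rewrite [_%:R * (_ * z)]mulrA -natrM divnK|rewrite mul0r].
have [k hk] := choice h; exists k => [i|]; first by case: (hk i).
rewrite /kernel_sum.
under eq_bigr => q _ do rewrite /kernel_coef -mulrA mulr_suml.
rewrite -mulr_sumr exchange_big /=; congr (_ * _); apply: eq_bigr => i _.
exact: (hk i).2.
Qed.

(** A cut at [K] meets at most one scale: those with [n ^ i.+1 <= K] are complete, hence at most 2,
    and those with [K <= n ^ i] vanish. The remaining scale is at most [2 / t], and averaging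
    divides it by [I]. *)
Lemma kernel_sum_bound n I z (t : R) K : (1 < n)%N -> (0 < I)%N -> 0 < t <= 1 ->
  1 <= n%:R * t ^+ 2 ->
  (forall i, (i < I)%N -> t <= `|sin ((n ^ i)%:R * z / 2)|) ->
  `|kernel_sum (kernel_coef n I) z K| <= 2 + 2 / (I%:R * t).
Proof.
move=> n1 I0 /andP[t0 t1] nt ts; have [k hk ->] := kernel_sumE I z K n1.
have n0 := ltnW n1.
have IR : 0 < I%:R :> R by rewrite ltr0n.
rewrite normrM ger0_norm ?invr_ge0// mulrC ler_pdivrMr//.
rewrite (_ : (2 + _) * _ = 2 * I%:R + 2 / t); last by field; rewrite !gt_eqF.
have [j hj] : exists j, forall i, i != j -> (n ^ i.+1 <= K)%N \/ (K <= n ^ i)%N.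
  have [->|K0] := posnP K; first by exists 0%N => i _; right.
  have /andP[j1 j2] := trunc_log_bounds n1 K0; exists (trunc_log n K) => i.
  rewrite neq_ltn => /orP[ij|ij]; [left|right].
    by rewrite (leq_trans _ j1)// leq_exp2l.
  by rewrite ltnW// (leq_trans j2)// leq_exp2l.
have term i : (i < I)%N -> i != j -> `|cofejer n ((n ^ i)%:R * z) (k i)| <= 2.
  move=> iI /hj[h|h]; have /andP[k1 k2] := hk i; have ni : (0 < n ^ i)%N by rewrite expn_gt0 n0.
    have nk : (n <= k i)%N.
      by rewrite -(leq_pmul2l ni) -expnSr (leq_trans h).
    have h1 := @cofejer_full R n ((n ^ i)%:R * z) (k i) t; rewrite n0 nk in h1.
    have {}h1 := h1 isT t0 (ts i iI).
    have h2 : (n%:R * t ^+ 2)^-1 <= 1 by rewrite invf_le1// (lt_le_trans ltr01).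
    rewrite -[X in `|X|](subrK 1); apply: le_trans (ler_normD _ _) _.
    rewrite normr1; lra.
  rewrite cofejer_le1 ?normr0//.
  rewrite -ltnS -(ltn_pmul2l ni); apply: leq_trans k2 _; rewrite muln2 -addnn.
  by rewrite leq_add2r.
apply: le_trans (ler_norm_sum _ _ _) _.
have [jI|jI] := ltnP j I; last first.
  apply: (@le_trans _ _ (\sum_(i < I) 2)).
    by apply: ler_sum => i _; apply: term => //; rewrite ltn_eqF// (leq_trans (ltn_ord i)).
  by rewrite sumr_const card_ord -[leLHS]mulr_natr lerDl divr_ge0// ltW.
rewrite (bigD1 (Ordinal jI))//= addrC; apply: lerD; last first.
  by apply: cofejer_partial => //; [exact/andP|exact: ts].
apply: (@le_trans _ _ (\sum_(i < I | i != Ordinal jI) 2)).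
  by apply: ler_sum => i ij; apply: term => //.
apply: (@le_trans _ _ (\sum_(i < I) 2)); last by rewrite sumr_const card_ord -[leLHS]mulr_natr.
by rewrite [leRHS](bigD1 (Ordinal jI))//= lerDr.
Qed.

Lemma kernel_sum_full n I z (t : R) : (1 < n)%N -> (0 < I)%N -> 0 < t ->
  (forall i, (i < I)%N -> t <= `|sin ((n ^ i)%:R * z / 2)|) ->
  `|kernel_sum (kernel_coef n I) z (n ^ I) - 1| <= (n%:R * t ^+ 2)^-1.
Proof.
move=> n1 I0 t0 ts; have [k hk ->] := kernel_sumE I z (n ^ I) n1.
have n0 := ltnW n1.
have IR : 0 < I%:R :> R by rewrite ltr0n.
rewrite [X in _ - X](_ : 1 = I%:R^-1 * \sum_(i < I) 1); last first.
  by rewrite sumr_const card_ord mulVf// gt_eqF.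
rewrite -mulrBr -sumrB normrM ger0_norm ?invr_ge0// mulrC ler_pdivrMr//.
apply: le_trans (ler_norm_sum _ _ _) _.
apply: (@le_trans _ _ (\sum_(i < I) (n%:R * t ^+ 2)^-1)); last first.
  by rewrite sumr_const card_ord -[leLHS]mulr_natr.
apply: ler_sum => i _; apply: cofejer_full => //; last exact: ts.
have /andP[k1 _] := hk i.
have ni : (0 < n ^ i)%N by rewrite expn_gt0 n0.
by rewrite n0 -(leq_pmul2l ni) -expnSr (leq_trans _ k1)// leq_exp2l.
Qed.

(* [C] must not depend on [e]: in the greedy selection the precision of a step is
   chosen in terms of the constant of the next one. *)
Lemma lacunary_kernel (L d : R) : 0 < d ->
  exists2 C, 0 <= C & forall e, 0 < e ->
  exists W : nat -> R, exists B : nat,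
  [/\ W 0%N = 0, forall q, (B <= q)%N -> W q = 0, forall q, `|W q| <= e &
   forall Q : nat, (0 < Q)%N -> mostly L d (fun x =>
     (forall K, `|kernel_sum W (Q%:R * x) K| <= C) /\
     `|kernel_sum W (Q%:R * x) B - 1| <= e)].
Proof.
move=> d0.
have [c c1 sinc] := mostly_sin_ge L.
(* This is [2 + 2 / (I * t)] for the threshold [t = d / (I * c)] chosen below; [I] cancels. *)
exists (2 + 2 * c / d) => [|e e0].
  by rewrite addr_ge0// divr_ge0 ?(ltW d0)// mulr_ge0// (le_trans ler01).
(* [I >= 1 / e] makes the coefficients small; [I >= d] ensures [t <= 1]. *)
pose I := (maxn (Num.bound e^-1) (Num.bound d)).+1.
have Ie : e^-1 <= I%:R.
  apply/ltW/(lt_le_trans (unstable.ltr_bound _)).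
  by rewrite ler_nat ltnW// ltnS leq_maxl.
have Id : d <= I%:R.
  apply/ltW/(lt_le_trans (unstable.ltr_bound _)).
  by rewrite ler_nat ltnW// ltnS leq_maxr.
have I0 : 0 < I%:R :> R by rewrite ltr0n.
(* Each of the [I] scales has an exceptional set of measure [c * t], in total [d]. *)
pose t := d / (I%:R * c).
have Ic0 : 0 < I%:R * c :> R by rewrite mulr_gt0// (lt_le_trans ltr01).
have t0 : 0 < t by rewrite divr_gt0.
have t1 : t <= 1.
  by rewrite ler_pdivrMr// mul1r (le_trans Id)// ler_peMr// ltW.
have t20 : 0 < t ^+ 2 by rewrite exprn_gt0.
(* The order [n] comes last: the complete kernel is accurate up to [1 / (n * t ^+ 2)], which has to
   be below 1 and below [e]. *)
pose v := Num.max 1 e^-1 / t ^+ 2.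
pose n := (Num.bound v).+2.
have vn : v <= n%:R.
  apply/ltW/(lt_le_trans (unstable.ltr_bound _)).
  by rewrite ler_nat leqW.
have vt : Num.max 1 e^-1 <= n%:R * t ^+ 2 by rewrite -ler_pdivrMr.
have nt1 : 1 <= n%:R * t ^+ 2 by apply: le_trans vt; rewrite le_max lexx.
have nte : e^-1 <= n%:R * t ^+ 2 by apply: le_trans vt; rewrite le_max lexx orbT.
exists (kernel_coef n I), (n ^ I)%N; split.
- exact: kernel_coef0.
- by move=> q; exact: kernel_coef_ge.
- move=> q; apply: le_trans (norm_kernel_coef I q _) _ => //.
  by rewrite -[leRHS]invrK lef_pV2// posrE invr_gt0.
- move=> Q Q0.
  have : mostly L (I%:R * (c * t))
      (fun x => forall i, (i < I)%N -> t <= `|sin ((Q * n ^ i)%:R * x / 2)|).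
    apply: mostly_forall => i _; apply: sinc; first exact: (ltW t0).
    by rewrite muln_gt0 Q0 expn_gt0.
  have -> : I%:R * (c * t) = d.
    by rewrite mulrA /t mulrCA divff ?mulr1// gt_eqF.
  move=> h; apply: mostlyS h _ => x _ h.
  have {}h i : (i < I)%N -> t <= `|sin ((n ^ i)%:R * (Q%:R * x) / 2)|.
    by move=> /h; rewrite natrM mulrA [_%:R * Q%:R]mulrC.
  split=> [K|].
    apply: (le_trans (@kernel_sum_bound n I _ t K _ _ _ _ h)) => //; first by rewrite t0 t1.
    rewrite lerD2l /t le_eqVlt; apply/orP; left; apply/eqP; field.
    by rewrite !gt_eqF// (lt_le_trans ltr01).
  apply: le_trans (kernel_sum_full _ _ t0 h) _ => //.
  by rewrite -[leRHS]invrK lef_pV2// posrE ?invr_gt0// (lt_le_trans ltr01).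
Qed.

End LacunaryKernel.

(** * The real-valued modulus on [R[i]] *)

Section ComplexModulus.
Local Open Scope complex_scope.
Context {R : realType}.
Implicit Types (z w : R[i]).

(** The norm of [R[i]] takes its values in [R[i]]; estimates need them in [R]. *)
Definition cabs z : R := complex.Re `|z|.

Lemma cabsE z : `|z| = (cabs z)%:C.
Proof. by rewrite /cabs normc_def. Qed.

Lemma cabs_ge0 z : 0 <= cabs z.
Proof. by rewrite /cabs normc_def /= sqrtr_ge0. Qed.

Lemma cabs0 : cabs 0 = 0.
Proof. by apply: complexI; rewrite -cabsE normr0. Qed.

Lemma cabs_eq0 z : (cabs z == 0) = (z == 0).
Proof. by rewrite -(inj_eq (@complexI R)) -cabsE normr_eq0. Qed.

Lemma cabsM z w : cabs (z * w) = cabs z * cabs w.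
Proof. by apply: complexI; rewrite rmorphM /= -!cabsE normrM. Qed.

Lemma cabsV z : cabs z^-1 = (cabs z)^-1.
Proof. by apply: complexI; rewrite fmorphV /= -!cabsE normfV. Qed.

Lemma cabsX z n : cabs (z ^+ n) = cabs z ^+ n.
Proof. by apply: complexI; rewrite rmorphXn /= -!cabsE normrX. Qed.

Lemma cabsN z : cabs (- z) = cabs z.
Proof. by apply: complexI; rewrite -!cabsE normrN. Qed.

Lemma cabsD z w : cabs (z + w) <= cabs z + cabs w.
Proof. by rewrite -lecR rmorphD /= -!cabsE ler_normD. Qed.

Lemma cabsB z w : cabs (z - w) <= cabs z + cabs w.
Proof. by rewrite -(cabsN w) cabsD. Qed.

Lemma cabs_dist u z w : cabs (z - w) <= cabs (z - u) + cabs (u - w).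
Proof. by have := cabsD (z - u) (u - w); rewrite addrA subrK. Qed.

Lemma cabs_distC z w : cabs (z - w) = cabs (w - z).
Proof. by rewrite -cabsN opprB. Qed.

Lemma cabs_real (x : R) : cabs x%:C = `|x|.
Proof. by rewrite /cabs normc_def /= expr0n addr0 sqrtr_sqr. Qed.

Lemma cabs_sum (I : Type) (r : seq I) (P : pred I) (F : I -> R[i]) :
  cabs (\sum_(i <- r | P i) F i) <= \sum_(i <- r | P i) cabs (F i).
Proof.
elim/big_rec2: _ => [|i y z _ h]; first by rewrite cabs0.
by apply: le_trans (cabsD _ _) _; rewrite lerD2l.
Qed.

Lemma cabs_le_ReIm (a b : R) : cabs (a +i* b) <= `|a| + `|b|.
Proof.
have -> : a +i* b = a%:C + b%:C * 'i by apply/eqP; rewrite eq_complex /=; simpc.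
apply: le_trans (cabsD _ _) _; rewrite cabsM !cabs_real.
by rewrite /cabs normc_def /= expr0n add0r expr1n sqrtr1 mulr1.
Qed.

Lemma Re_le_cabs z : `|complex.Re z| <= cabs z.
Proof. by rewrite -lecR -cabsE normc_ge_Re. Qed.

Lemma Im_le_cabs z : `|complex.Im z| <= cabs z.
Proof.
have := Re_le_cabs (z * 'i); rewrite ReiNIm normrN cabsM.
by rewrite [cabs 'i]/cabs normc_def /= expr0n add0r expr1n sqrtr1 mulr1.
Qed.

Lemma expiD (s t : R) : expi (s + t) = expi s * expi t.
Proof. by apply/eqP; rewrite /expi eq_complex /= cosD sinD [_ + cos s * sin t]addrC !eqxx. Qed.

Lemma cabs_expi (t : R) : cabs (expi t) = 1.
Proof. by rewrite /cabs normc_def /= cos2Dsin2 sqrtr1. Qed.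

Lemma expi_addN (t : R) : expi t + expi (- t) = (2 * cos t)%:C.
Proof.
by apply/eqP; rewrite /expi cosN sinN eq_complex /=; apply/andP; split; apply/eqP; ring.
Qed.

End ComplexModulus.

(** * Finite sums of perturbed exponentials and their product with a kernel *)

Section TermLists.
Local Open Scope complex_scope.
Context {R : realType} (rho : nat -> R).

(* [(n, k, c)] stands for the exponential [c * expi ((n + rho k) * x)]. *)
Definition term : Type := (int * nat * R[i])%type.
Implicit Types (t : term) (T : seq term) (x : R) (N k : nat) (A : pred int).

Definition tval t x : R[i] := t.2 * expi ((t.1.1%:~R + rho t.1.2) * x).
Definition psum T A x : R[i] := \sum_(t <- T | A t.1.1) tval t x.
Definition tsum T x : R[i] := psum T predT x.
Definition tnorm T : R := \sum_(t <- T) cabs t.2.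

(** The bound [N] keeps stages in disjoint shells; the bound [k] on the perturbation indices makes
    each [rho k] occur finitely often. *)
Definition good N k T : bool :=
  uniq [seq t.1.1 | t <- T] && all (fun t => (N < `|t.1.1|)%N && (k <= t.1.2)%N) T.

(** The shell [|n| = M] is left undecided, because the cut [|lam n| < eta] may separate integers of
    equal modulus. *)
Definition initial A : Prop :=
  exists M : nat, (forall n : int, (`|n| < M)%N -> A n) /\
    (forall n : int, A n -> (`|n| <= M)%N).

Lemma tnorm_ge0 T : 0 <= tnorm T.
Proof. by apply: sumr_ge0 => t _; exact: cabs_ge0. Qed.

Lemma cabs_psum T A x : cabs (psum T A x) <= tnorm T.
Proof.
apply: le_trans (cabs_sum _ _ _) _.
rewrite big_mkcond; apply: ler_sum => t _.
by case: ifP; rewrite ?cabs_ge0// /tval cabsM cabs_expi mulr1.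
Qed.

Lemma psum_all T A x : {in T, forall t, A t.1.1} -> psum T A x = tsum T x.
Proof.
move=> TA; rewrite /psum /tsum /psum big_seq_cond [RHS]big_seq_cond.
by apply: eq_bigl => t; case: (boolP (t \in T)) => //= /TA ->.
Qed.

Lemma psum_none T A x : {in T, forall t, ~~ A t.1.1} -> psum T A x = 0.
Proof.
move=> TA; rewrite /psum big_seq_cond big_pred0// => t.
by case: (boolP (t \in T)) => //= /TA /negbTE.
Qed.

Lemma psum_cat T1 T2 A x : psum (T1 ++ T2) A x = psum T1 A x + psum T2 A x.
Proof. exact: big_cat. Qed.

Lemma tsum_cat T1 T2 x : tsum (T1 ++ T2) x = tsum T1 x + tsum T2 x.
Proof. exact: psum_cat. Qed.

Lemma terms_bounded T : exists D : nat, {in T, forall t, (`|t.1.1| <= D)%N}.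
Proof.
exists (\max_(t <- T) `|t.1.1|)%N => t tT.
exact: (@leq_bigmax_seq _ T predT (fun t : term => absz t.1.1) t tT).
Qed.

Lemma good_cat N N' k T1 T2 : (N <= N')%N -> good N k T1 ->
  {in T1, forall t, (`|t.1.1| <= N')%N} -> good N' k T2 -> good N k (T1 ++ T2).
Proof.
move=> NN /andP[u1 a1] b1 /andP[u2 a2]; apply/andP; split; last first.
  rewrite all_cat a1 /=; apply/allP => t /(allP a2) /andP[h1 ->].
  by rewrite (leq_ltn_trans NN).
rewrite map_cat cat_uniq u1 u2 andbT /=; apply/hasPn => _ /mapP[t t2 ->].
apply/negP => /mapP[s s1 e]; have := b1 s s1; rewrite -e leqNgt.
by have /andP[-> _] := allP a2 t t2.
Qed.

Definition shift (a : int) (w : R) t : term := (t.1.1 + a, t.1.2, w%:C * t.2).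

Lemma tval_shift a w t x :
  tval (shift a w t) x = w%:C * (expi (a%:~R * x) * tval t x).
Proof.
rewrite /tval /= intrD (_ : (_ + _ + _) * x = a%:~R * x + (t.1.1%:~R + rho t.1.2) * x); last by ring.
rewrite expiD /tval; set u := expi _; set v := expi _; ring.
Qed.

Lemma psum_shift a w T A x : psum [seq shift a w t | t <- T] A x =
  w%:C * (expi (a%:~R * x) * psum T (fun n => A (n + a)) x).
Proof.
rewrite /psum big_map !mulr_sumr; apply: eq_bigr => t _; exact: tval_shift.
Qed.

Lemma map_shift a w T : [seq t.1.1 | t <- [seq shift a w t | t <- T]] =
  [seq n + a | n <- [seq t.1.1 | t <- T]].
Proof. by rewrite -!map_comp. Qed.

(** The terms of the product of [T] with [W(Qx)]. The layer [k = 0] is left out since [W 0 = 0]. *)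
Definition spread (Q B : nat) (W : nat -> R) T : seq term :=
  flatten [seq [seq shift (k * Q)%N%:Z (W k) t | t <- T] ++
               [seq shift (- (k * Q)%N%:Z) (W k) t | t <- T] | k <- iota 1 B.-1].

Definition spread_layer (Q : nat) (W : nat -> R) T A x k : R[i] :=
  (W k)%:C * (expi ((k * Q)%N%:R * x) * psum T (fun n => A (n + (k * Q)%N%:Z)) x) +
  (W k)%:C * (expi (- ((k * Q)%N%:R * x)) * psum T (fun n => A (n - (k * Q)%N%:Z)) x).

Lemma psum_spread Q B W T A x : W 0%N = 0 ->
  psum (spread Q B W T) A x = \sum_(k < B) spread_layer Q W T A x k.
Proof.
move=> W0; rewrite -(big_mkord xpredT (spread_layer Q W T A x)).
case: B => [|B]; first by rewrite big_geq// /spread /psum big_nil.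
rewrite big_ltn// {1}/spread_layer W0 !mul0r !add0r.
rewrite /psum /spread big_flatten big_map /index_iota subn1.
apply: eq_bigr => k _; rewrite -[LHS]/(psum _ A x) psum_cat !psum_shift.
by rewrite mulrNz mulNr /spread_layer pmulrn.
Qed.

Lemma tsum_spread Q B W T x : W 0%N = 0 ->
  tsum (spread Q B W T) x = (kernel_sum W (Q%:R * x) B)%:C * tsum T x.
Proof.
move=> W0; rewrite /tsum psum_spread// /kernel_sum rmorph_sum mulr_suml.
apply: eq_bigr => k _; rewrite /spread_layer -/(tsum T x) -mulrDr -mulrDl expi_addN.
by rewrite mulrA -rmorphM natrM -[_ * _ * x]mulrA.
Qed.

(** For [2 * D < Q] the clusters of radius [D] around the multiples of [Q] are disjoint. A cut meets
    at most one layer; the layers before it are complete and form a truncated kernel times [tsum T],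
    and the cut layer, of coefficient at most [e], is the error. *)
Lemma psum_spread_initial Q B D W T A (e x : R) : W 0%N = 0 ->
    (forall q, (B <= q)%N -> W q = 0) -> (forall q, `|W q| <= e) ->
    {in T, forall t, (`|t.1.1| <= D)%N} -> (2 * D < Q)%N -> initial A ->
  exists K, cabs (psum (spread Q B W T) A x -
      (kernel_sum W (Q%:R * x) K)%:C * tsum T x) <= 2 * e * tnorm T.
Proof.
move=> W0 WB We TD DQ [M [M1 M2]].
(* [j] is the only layer that the cut can split. *)
have [j jP jmin] : {j | (M <= j * Q + D)%N & forall k, (M <= k * Q + D)%N -> (j <= k)%N}.
  have ex : exists j, (M <= j * Q + D)%N by exists M; nia.
  by exists (ex_minn ex); case: ex_minnP.
pose g := spread_layer Q W T A x.
have g0 k : (j < k)%N -> g k = 0.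
  move=> jk; rewrite /g /spread_layer !psum_none ?mulr0 ?addr0// => t /TD tD.
    apply/negP => /M2; move: jP jk tD DQ; clear; nia.
  apply/negP => /M2; move: jP jk tD DQ; clear; nia.
have gB k : (B <= k)%N -> g k = 0.
  by move=> /WB h; rewrite /g /spread_layer h !mul0r addr0.
have stable m n : (forall k, (m <= k)%N -> g k = 0) ->
    \sum_(k < m + n) g k = \sum_(k < m) g k.
  move=> h; rewrite big_split_ord /= [X in _ + X]big1 ?addr0// => i _.
  by apply: h; rewrite leq_addr.
exists j; rewrite psum_spread//.
(* Layers vanish from [B] on and beyond [j]; as either may be larger, both sums are extended to
   [B + j.+1]. *)
rewrite -/(\sum_(k < B) g k) -(stable B j.+1 gB) addnC (stable j.+1 B g0).
rewrite big_ord_recr /=.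
have -> : \sum_(k < j) g k = (kernel_sum W (Q%:R * x) j)%:C * tsum T x.
  rewrite /kernel_sum rmorph_sum mulr_suml; apply: eq_bigr => k _.
  have [->|k0] := eqVneq (k : nat) 0%N.
    by rewrite /g /spread_layer W0 !mul0r add0r.
  have kj : (k * Q + D < M)%N.
    by rewrite ltnNge; apply/negP => /jmin; rewrite leqNgt ltn_ord.
  rewrite /g /spread_layer !psum_all; last 2 first.
  - by move=> t /TD tD; apply: M1; move: kj tD; clear; lia.
  - by move=> t /TD tD; apply: M1; move: kj tD; clear; lia.
  rewrite -mulrDr -mulrDl expi_addN.
  by rewrite mulrA -rmorphM natrM -[_ * _ * x]mulrA.
rewrite addrAC subrr add0r /g /spread_layer; apply: le_trans (cabsD _ _) _.
rewrite !cabsM !cabs_expi !cabs_real !mul1r -mulrA mulr2n mulrDl mul1r.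
by apply: lerD; apply: ler_pM; rewrite ?cabs_ge0 ?cabs_psum.
Qed.

Lemma uniq_flatten_map (K : eqType) (F : K -> seq int) (s : seq K) : uniq s ->
  {in s, forall i, uniq (F i)} ->
  {in s &, forall i j n, n \in F i -> n \in F j -> i = j} ->
  uniq (flatten [seq F i | i <- s]).
Proof.
elim: s => //= i s IH /andP[us us'] uF dF.
rewrite cat_uniq uF ?mem_head//= IH//; last 2 first.
- by move=> j js; apply: uF; rewrite inE js orbT.
- by move=> a b a1 b1; apply: dF; rewrite inE ?a1 ?b1 orbT.
rewrite andbT; apply/hasPn => n /flatten_mapP[j js nj]; apply/negP => ni.
have e : i = j by apply: (dF i j _ _ n ni nj); rewrite inE ?eqxx// js orbT.
by move: us; rewrite e js.
Qed.

Lemma good_spread Q B D W T N k0 : uniq [seq t.1.1 | t <- T] ->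
  {in T, forall t, (k0 <= t.1.2)%N} -> {in T, forall t, (`|t.1.1| <= D)%N} ->
  (2 * D < Q)%N -> (N + D < Q)%N -> good N k0 (spread Q B W T).
Proof.
move=> uT kT TD DQ NQ; apply/andP; split; last first.
  apply/allP => s /flatten_mapP[k]; rewrite mem_iota => /andP[k1 _].
  rewrite mem_cat => /orP[] /mapP[t tT ->] /=; rewrite (kT t tT) andbT;
  by have := TD t tT; move: NQ k1; clear; nia.
rewrite /spread map_flatten -map_comp; apply: uniq_flatten_map.
- exact: iota_uniq.
- move=> k; rewrite mem_iota => /andP[k1 _] /=; rewrite map_cat !map_shift.
  have nsD n : n \in [seq t.1.1 | t <- T] -> (`|n| <= D)%N by move=> /mapP[t /TD tD ->].
  move: uT nsD; move: (map _ T) => ns uns nsD.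
  rewrite cat_uniq !map_inj_uniq ?uns ?andbT /=; try exact: addIr.
    apply/hasPn => _ /mapP[m /nsD mD ->]; apply/negP => /mapP[n /nsD nD].
  by move: DQ k1 mD nD; clear; nia.
- move=> k k'; rewrite !mem_iota => /andP[k1 _] /andP[k1' _] n /=.
  (* [|n|] is within [D] of [j * Q], which determines [j] because [2 * D < Q]. *)
  have key j : (0 < j)%N -> n \in [seq t.1.1 | t <- [seq shift (j * Q)%N%:Z (W j) t | t <- T] ++
      [seq shift (- (j * Q)%N%:Z) (W j) t | t <- T]] -> (absz ((absz n)%:Z - (j * Q)%N%:Z)%R <= D)%N.
    move=> j0; rewrite map_cat mem_cat => /orP[] /mapP[_ /mapP[t tT ->] ->] /=;
    by have := TD t tT; move: DQ j0; clear; nia.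
  by move=> /(key k k1) h1 /(key k' k1') h2; move: DQ h1 h2; clear; nia.
Qed.

End TermLists.

(** * The closure in measure of the perturbed exponentials *)

Section Spanned.
Local Open Scope complex_scope.
Context {R : realType} (rho : nat -> R).
Local Notation tsum := (tsum rho).
Local Notation psum := (psum rho).
Implicit Types (g h : R -> R[i]) (k N : nat).

(** Approximants are required beyond every [N]: those of two functions can then be given disjoint
    sets of integers, and their concatenation is still [good]. *)
Definition spanned k g : Prop := forall (L d e : R) N, 0 < d -> 0 < e ->
  exists T, good N k T /\ mostly L d (fun x => cabs (tsum T x - g x) <= e).

Lemma eq_spanned k g h : g =1 h -> spanned k g -> spanned k h.
Proof. by move=> /funext ->. Qed.

Lemma spanned_lim k g : (forall (L d e : R), 0 < d -> 0 < e ->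
    exists h, spanned k h /\ mostly L d (fun x => cabs (h x - g x) <= e)) ->
  spanned k g.
Proof.
move=> gP L d e N d0 e0.
have d2 : 0 < d / 2 by rewrite divr_gt0.
have e2 : 0 < e / 2 by rewrite divr_gt0.
have [h [hS hg]] := gP L _ _ d2 e2.
have [T [Tg Th]] := hS L _ _ N d2 e2.
exists T; split => //; have := mostlyI Th hg; rewrite -splitr.
move=> m; apply: mostlyS m _ => x _ [h1 h2].
by apply: le_trans (cabs_dist (h x) _ _) _; lra.
Qed.

Lemma spanned0 k : spanned k (fun=> 0).
Proof.
move=> L d e N d0 e0; exists [::]; split => //; apply: mostly_all => [|x _]; first exact: ltW.
by rewrite /tsum /psum big_nil subrr cabs0 ltW.
Qed.

Lemma spannedD k g h : spanned k g -> spanned k h -> spanned k (fun x => g x + h x).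
Proof.
move=> gS hS L d e N d0 e0.
have d2 : 0 < d / 2 by rewrite divr_gt0.
have e2 : 0 < e / 2 by rewrite divr_gt0.
have [T [Tg Th]] := gS L _ _ N d2 e2.
have [D TD] := terms_bounded T.
have [T' [Tg' Th']] := hS L _ _ (maxn N D) d2 e2.
exists (T ++ T'); split.
  apply: good_cat Tg' => //; first exact: leq_maxl.
  by move=> t /TD tD; rewrite leq_max tD orbT.
have := mostlyI Th Th'; rewrite -splitr => m; apply: mostlyS m _ => x _ [h1 h2].
rewrite tsum_cat opprD addrACA; apply: le_trans (cabsD _ _) _; lra.
Qed.

Lemma spannedZ k (a : R[i]) g : spanned k g -> spanned k (fun x => a * g x).
Proof.
move=> gS; have [->|a0] := eqVneq a 0.
  by apply: eq_spanned (spanned0 k) => x; rewrite mul0r.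
have ca : 0 < cabs a by rewrite lt_neqAle cabs_ge0 eq_sym cabs_eq0 a0.
move=> L d e N d0 e0.
have [|T [Tg Th]] := gS L d (e / cabs a) N d0; first by rewrite divr_gt0.
exists [seq (t.1, a * t.2) | t <- T]; split.
  move: Tg; rewrite /good -map_comp all_map.
  by rewrite (@eq_map _ _ _ (fun t : term => t.1.1)).
apply: mostlyS Th _ => x _; rewrite ler_pdivlMr// mulrC -cabsM mulrBr.
congr (cabs (_ - _) <= _).
rewrite /tsum /psum big_map mulr_sumr; apply: eq_bigr => t _.
by rewrite /tval /= mulrA.
Qed.

Lemma spanned_sum k (I : Type) (r : seq I) (G : I -> R -> R[i]) :
  (forall i, spanned k (G i)) -> spanned k (fun x => \sum_(i <- r) G i x).
Proof.
move=> GS; elim: r => [|i r IH].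
  by apply: eq_spanned (spanned0 k) => x; rewrite big_nil.
by apply: eq_spanned (spannedD (GS i) IH) => x; rewrite big_cons.
Qed.

(** The exponential itself has integer part 0; multiplication by a kernel close to 1 in [N.+1 * x]
    moves it beyond [N]. *)
Lemma spanned_expi k j : (k <= j)%N -> spanned k (fun x => expi (rho j * x)).
Proof.
move=> kj L d e N d0 e0.
have [C C0 /(_ e e0)[W [B [W0 WB We Wm]]]] := lacunary_kernel L d0.
exists (spread N.+1 B W [:: (0, j, 1)]); split.
  apply: (@good_spread _ N.+1 B 0) => //.
  - by move=> t; rewrite inE => /eqP ->.
  - by move=> t; rewrite inE => /eqP ->.
  - by rewrite addn0.
apply: mostlyS (Wm N.+1 isT) _ => x _ [_ h].
have -> : expi (rho j * x) = tsum [:: (0, j, 1)] x.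
  by rewrite /tsum /psum big_seq1 /tval /= mul1r mulr0z add0r.
rewrite tsum_spread// -[X in _ - X]mul1r -mulrBl cabsM.
rewrite /tsum /psum big_seq1 /tval /= mul1r cabs_expi mulr1.
by rewrite -(rmorph1 (real_complex R)) -rmorphB cabs_real.
Qed.

(** The order of choices matters: [C] comes from [L] and [d] alone, then [T] approximates [g], then
    the kernel precision is adapted to [tnorm T], and finally [Q] to the frequencies of [T]. *)
Lemma spanned_stage (L d : R) : 0 < d -> exists2 C, 0 <= C &
  forall k g, spanned k g -> forall e N, 0 < e -> exists T, good N k T /\
    mostly L d (fun x => cabs (tsum T x - g x) <= e /\
      forall A, initial A -> cabs (psum T A x) <= C * cabs (g x) + e).
Proof.
move=> d0; have d2 : 0 < d / 2 by rewrite divr_gt0.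
have [C C0 WP] := lacunary_kernel L d2.
exists C => // k g gS e N e0.
(* The error of [T] gets multiplied by [C] in the bound on partial sums and must then still be at
   most [e / 2]. *)
have e1 : 0 < e / (2 * (C + 1)) by rewrite divr_gt0// mulr_gt0// ltr_wpDl.
have [T [Tg Th]] := gS L _ _ N d2 e1.
have T0 := tnorm_ge0 T.
have e2 : 0 < e / (4 * (tnorm T + 1)) by rewrite divr_gt0// mulr_gt0// ltr_wpDl.
have [W [B [W0 WB We Wm]]] := WP _ e2.
have [D TD] := terms_bounded T.
pose Q := (N + 2 * D).+1.
have DQ : (2 * D < Q)%N by rewrite ltnS leq_addl.
have NQ : (N + D < Q)%N by rewrite ltnS leq_add2l leq_pmull.
exists (spread Q B W T); split.
  have /andP[uT aT] := Tg.
  apply: (good_spread _ _ uT _ TD DQ NQ) => t /(allP aT) /andP[_ kt].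
  exact: kt.
have := mostlyI (Wm Q isT) Th; rewrite -splitr => m; apply: mostlyS m _.
move=> x _ [[h1 h2] h3].
have h5 : e / (2 * (C + 1)) * (C + 1) = e / 2.
  by field; rewrite gt_eqF// ltr_wpDl.
have h6 : e / (4 * (tnorm T + 1)) * (tnorm T + 1) = e / 4.
  by field; rewrite gt_eqF// ltr_wpDl.
move: e1 e2 h2 h3 We h5 h6; set a := e / (2 * _); set b := e / (4 * _) => a0 b0 h2 h3 We h5 h6.
have aC : 0 <= a * C by rewrite mulr_ge0// ltW.
have bT : 0 <= b * tnorm T by rewrite mulr_ge0// ltW.
have Tx : cabs (tsum T x) <= tnorm T by exact: cabs_psum.
split.
  apply: le_trans (cabs_dist (tsum T x) _ _) _.
  have : cabs (tsum (spread Q B W T) x - tsum T x) <= b * tnorm T.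
    rewrite tsum_spread// -[X in _ - X]mul1r -mulrBl cabsM.
    rewrite -(rmorph1 (real_complex R)) -rmorphB cabs_real.
    by apply: ler_pM => //; exact: cabs_ge0.
  by move: h5 h6; lra.
move=> A iA.
have [K hK] := psum_spread_initial rho x W0 WB We TD DQ iA.
rewrite -[X in cabs X](subrK ((kernel_sum W (Q%:R * x) K)%:C * tsum T x)).
apply: le_trans (cabsD _ _) _; rewrite [in X in _ + X]cabsM cabs_real.
have gx : cabs (tsum T x) <= cabs (g x) + a.
  by have := cabsD (tsum T x - g x) (g x); rewrite subrK; lra.
have : `|kernel_sum W (Q%:R * x) K| * cabs (tsum T x) <= C * (cabs (g x) + a).
  by apply: ler_pM => //; exact: cabs_ge0.
by move: h5 h6 hK; lra.
Qed.

End Spanned.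

(** * Taylor expansion of the exponential *)

Section TaylorExpi.
Local Open Scope complex_scope.
Context {R : realType}.

Lemma sum_geometric_le (t : R) m : 0 <= t <= 1 / 2 ->
  \sum_(q < m) t ^+ q <= 2 - 2 * t ^+ m.
Proof.
move=> /andP[t0 t1]; elim: m => [|m IH]; first by rewrite big_ord0 expr0; lra.
rewrite big_ord_recr /= exprS.
have : t * t ^+ m <= 1 / 2 * t ^+ m by rewrite ler_wpM2r// exprn_ge0.
by move: IH; lra.
Qed.

Lemma power_series_tail (a : nat -> R) (y l : R) p : (forall n, `|a n| <= 1) ->
  `|y| <= 1 / 2 -> series (fun n => a n * y ^+ n) @ \oo --> l ->
  `|l - \sum_(q < p) a q * y ^+ q| <= 2 * `|y| ^+ p.
Proof.
move=> a1 y1; set u := series _ => ul.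
have up n : (p <= n)%N -> `|u n - \sum_(q < p) a q * y ^+ q| <= 2 * `|y| ^+ p.
  move=> pn; rewrite /u /series /= big_mkord -(subnKC pn) big_split_ord /=.
  rewrite addrAC subrr add0r; apply: le_trans (ler_norm_sum _ _ _) _.
  apply: (@le_trans _ _ (\sum_(i < n - p) `|y| ^+ p * `|y| ^+ i)).
    apply: ler_sum => i _; rewrite normrM normrX exprD ler_piMl ?a1//.
  rewrite -mulr_sumr mulrC ler_wpM2r ?exprn_ge0//.
  apply: le_trans (sum_geometric_le _ _) _; first by rewrite normr_ge0.
  by rewrite gerBl mulr_ge0// exprn_ge0.
have cu : cvg (u @ \oo) by apply/cvg_ex; exists l.
have lE : l = lim (u @ \oo) by apply/esym/cvg_lim.
rewrite ler_norml lE; apply/andP; split.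
  rewrite lerBrDr; apply: limr_ge => //; exists p => // n /= /up.
  by rewrite ler_norml => /andP[]; rewrite lerBrDr.
rewrite lerBlDr; apply: limr_le => //; exists p => // n /= /up.
by rewrite ler_norml => /andP[_]; rewrite lerBlDr.
Qed.

(** This is [i^n / n!], split into the coefficients of the cosine and sine series. *)
Definition expi_coef (n : nat) : R[i] :=
  ((~~ odd n)%:R * (-1) ^+ n./2 * (n`!%:R)^-1) +i*
  ((odd n)%:R * (-1) ^+ n.-1./2 * (n`!%:R)^-1).

Lemma expi_coef_neq0 n : expi_coef n != 0.
Proof.
have f0 : (n`!%:R : R)^-1 != 0 by rewrite invr_eq0 pnatr_eq0 -lt0n fact_gt0.
rewrite /expi_coef eq_complex /=; case: odd => /=; rewrite !mul1r ?mul0r !mulf_eq0.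
  by rewrite (negbTE f0) signr_eq0 andbF.
by rewrite (negbTE f0) signr_eq0.
Qed.

Lemma expi_taylor (y : R) p : `|y| <= 1 / 2 ->
  cabs (expi y - \sum_(q < p) expi_coef q * (y ^+ q)%:C) <= 4 * `|y| ^+ p.
Proof.
move=> y1.
have b (s : bool) n m : `|s%:R * (-1) ^+ m * (n`!%:R)^-1| <= 1 :> R.
  rewrite !normrM normrX normrN1 expr1n mulr1 normr_nat normfV normr_nat.
  rewrite ler_pdivrMr ?mul1r ?ltr0n ?fact_gt0// ler_nat.
  by rewrite (leq_trans (leq_b1 s)) ?fact_gt0.
have hc := @power_series_tail _ y (cos y) p (fun n => b (~~ odd n) n n./2) y1.
have hs := @power_series_tail _ y (sin y) p (fun n => b (odd n) n n.-1./2) y1.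
have cc := @is_cvg_series_cos_coeff R y.
have cs := @is_cvg_series_sin_coeff R y.
rewrite cos_coeffE in cc; rewrite sin_coeffE in cs.
have {}hc := hc _; have {}hs := hs _.
have -> : \sum_(q < p) expi_coef q * (y ^+ q)%:C =
  (\sum_(q < p) (~~ odd q)%:R * (-1) ^+ q./2 * (q`!%:R)^-1 * y ^+ q) +i*
  (\sum_(q < p) (odd q)%:R * (-1) ^+ q.-1./2 * (q`!%:R)^-1 * y ^+ q).
  elim: p {hc hs} => [|p IH]; first by rewrite !big_ord0.
  rewrite !big_ord_recr /= IH /expi_coef; apply/eqP.
  by rewrite eq_complex /= !mulr0 subr0 add0r !eqxx.
rewrite (_ : 4 * _ = 2 * `|y| ^+ p + 2 * `|y| ^+ p); last by lra.
apply: le_trans (cabs_le_ReIm _ _) _; apply: lerD.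
  by apply: hc; rewrite cosE; exact: cc.
by apply: hs; rewrite sinE; exact: cs.
Qed.

End TaylorExpi.

(** * Polynomials lie in the closure *)

Section SpannedPolynomials.
Local Open Scope complex_scope.
Context {R : realType} (rho : nat -> R).
Hypotheses (rho_neq0 : forall k, rho k != 0) (rho_cvg : rho @ \oo --> (0 : R)).

Lemma rho_small k (e : R) : 0 < e -> exists2 j, (k <= j)%N & `|rho j| <= e.
Proof.
move=> e0; have /cvgrPdist_le/(_ e e0)[N _ h] := rho_cvg.
exists (maxn k N); first exact: leq_maxl.
by have := h (maxn k N) (leq_maxr _ _); rewrite sub0r normrN.
Qed.

(** Strong induction: the expansion of [expi (r * x)], [r = rho j], is solved for [x ^+ p]. Division
    by [r ^+ p] needs [r != 0] and leaves an error of order [r], small for a suitable [j >= k]. *)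
Lemma spanned_monomial k p : spanned rho k (fun x => (x ^+ p)%:C).
Proof.
elim/ltn_ind: p => p IH; apply: spanned_lim => L d e d0 e0.
pose c : R[i] := expi_coef p; have c0 : 0 < cabs c.
  by rewrite lt_neqAle cabs_ge0 eq_sym cabs_eq0 expi_coef_neq0.
pose M := `|L| + 1; have M1 : 1 <= M by rewrite lerDr.
have M0 : 0 < M by rewrite (lt_le_trans ltr01).
(* The first bound brings [r * x] into the range of [expi_taylor]; the second makes the remainder,
   divided by [c * r ^+ p], at most [e]. *)
have eM : 0 < Num.min (1 / 2 / M) (e * cabs c / (4 * M ^+ p.+1)).
  by rewrite lt_min !divr_gt0// !mulr_gt0// exprn_gt0.
have [j kj] := rho_small k eM; rewrite le_min => /andP[r1 r2].
set r := rho j in r1 r2 *; have r0 : 0 < `|r| by rewrite normr_gt0 rho_neq0.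
have rC0 : r%:C != 0 by rewrite -cabs_eq0 cabs_real gt_eqF.
pose h x := (c * r%:C ^+ p)^-1 * (expi (r * x) +
   \sum_(q < p) - (expi_coef q * r%:C ^+ q) * (x ^+ q)%:C).
exists h; split.
  apply: spannedZ; apply: spannedD; first exact: spanned_expi.
  by apply: spanned_sum => q; apply: spannedZ; exact: IH.
apply: mostly_all => [|x xL]; first exact: ltW.
have xM : `|x| <= M by rewrite (le_trans xL)// /M (le_trans (ler_norm L))// lerDl.
have rx : `|r * x| <= 1 / 2.
  rewrite normrM; apply: (@le_trans _ _ (1 / 2 / M * M)); last by rewrite divfK// gt_eqF.
  exact: ler_pM.
have := expi_taylor p.+1 rx; rewrite big_ord_recr /= -/c.
have -> : h x - (x ^+ p)%:C = (c * r%:C ^+ p)^-1 * (expi (r * x) -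
    (\sum_(q < p) expi_coef q * ((r * x) ^+ q)%:C + c * ((r * x) ^+ p)%:C)).
  rewrite /h (_ : \sum_(q < p) _ = - \sum_(q < p) expi_coef q * ((r * x) ^+ q)%:C); last first.
    rewrite -sumrN; apply: eq_bigr => q _.
    by rewrite exprMn [in RHS]rmorphM /= [(r ^+ q)%:C]rmorphXn; ring.
  rewrite [in RHS]exprMn [(r ^+ p * x ^+ p)%:C]rmorphM /= [(r ^+ p)%:C]rmorphXn /=.
  rewrite opprD addrA [RHS]mulrBr; congr (_ - _).
  by rewrite [c * (_ * _)]mulrA mulKf// mulf_neq0 ?expf_neq0// -cabs_eq0 gt_eqF.
move=> ht; rewrite cabsM cabsV cabsM cabsX cabs_real.
have cr : 0 < cabs c * `|r| ^+ p by rewrite mulr_gt0// exprn_gt0.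
rewrite mulrC ler_pdivrMr//; apply: le_trans ht _.
rewrite normrM exprMn.
apply: (@le_trans _ _ (4 * (`|r| ^+ p.+1 * M ^+ p.+1))).
  by rewrite ler_pM2l// ler_pM2l ?exprn_gt0// lerXn2r ?nnegrE// ltW.
move: r2; rewrite ler_pdivlMr ?mulr_gt0 ?exprn_gt0// => r2.
rewrite [e * _]mulrA (_ : 4 * _ = `|r| * (4 * M ^+ p.+1) * `|r| ^+ p); last first.
  by rewrite [`|r| ^+ p.+1]exprS; ring.
by rewrite ler_wpM2r// exprn_ge0.
Qed.

Lemma spanned_poly k (p : {poly R[i]}) : spanned rho k (fun x => p.[x%:C]).
Proof.
have : spanned rho k (fun x => \sum_(i <- index_enum 'I_(size p)) p`_i * (x ^+ i)%:C).
  by apply: spanned_sum => i; apply: spannedZ; exact: spanned_monomial.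
apply: eq_spanned => x; rewrite horner_coef; apply: eq_bigr => i _.
by rewrite rmorphXn.
Qed.

End SpannedPolynomials.

(** * Polynomial approximation in measure: indicators of half-lines *)

Section PolynomialDensity.
Context {R : realType}.
Implicit Types (u v : R -> R) (A : set R) (L d e : R).
Notation mu := (@lebesgue_measure R).

Definition polymost u : Prop := forall L d e, 0 < d -> 0 < e ->
  exists p : {poly R}, mostly L d (fun x => `|u x - p.[x]| <= e).

Lemma polymost_lim u : (forall L d e, 0 < d -> 0 < e ->
    exists v, polymost v /\ mostly L d (fun x => `|u x - v x| <= e)) -> polymost u.
Proof.
move=> uP L d e d0 e0.
have d2 : 0 < d / 2 by rewrite divr_gt0.
have e2 : 0 < e / 2 by rewrite divr_gt0.
have [v [vP uv]] := uP L _ _ d2 e2.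
have [p vp] := vP L _ _ d2 e2.
exists p; have := mostlyI uv vp; rewrite -splitr.
move=> m; apply: mostlyS m _ => x _ [h1 h2].
by rewrite (le_trans (ler_distD (v x) _ _))// [e]splitr lerD.
Qed.

Lemma polymost_horner (p : {poly R}) : polymost (fun x => p.[x]).
Proof.
move=> L d e d0 e0; exists p; apply: mostly_all => [|x _]; first exact: ltW.
by rewrite subrr normr0 ltW.
Qed.

Lemma polymostD u v : polymost u -> polymost v -> polymost (fun x => u x + v x).
Proof.
move=> uP vP L d e d0 e0.
have d2 : 0 < d / 2 by rewrite divr_gt0.
have e2 : 0 < e / 2 by rewrite divr_gt0.
have [p hp] := uP L _ _ d2 e2; have [q hq] := vP L _ _ d2 e2.
exists (p + q); have := mostlyI hp hq; rewrite -splitr.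
move=> m; apply: mostlyS m _ => x _ [h1 h2].
by rewrite hornerD opprD addrACA (le_trans (ler_normD _ _))// [e]splitr lerD.
Qed.

Lemma polymostZ (a : R) u : polymost u -> polymost (fun x => a * u x).
Proof.
move=> uP L d e d0 e0.
have a0 : 0 < `|a| + 1 by rewrite ltr_wpDl.
have [|p hp] := uP L d (e / (`|a| + 1)) d0; first by rewrite divr_gt0.
exists (a *: p); apply: mostlyS hp _ => x _ h.
rewrite hornerZ -mulrBr normrM; apply: le_trans (ler_wpM2l _ h) _ => //.
by rewrite mulrCA ger_pMr// ler_pdivrMr// mul1r lerDl.
Qed.

Lemma polymostM u v : (forall x, `|u x| <= 1) -> (forall x, `|v x| <= 1) ->
  polymost u -> polymost v -> polymost (fun x => u x * v x).
Proof.
move=> u1 v1 uP vP L d e d0 e0.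
have d2 : 0 < d / 2 by rewrite divr_gt0.
have e3 : 0 < Num.min 1 (e / 3) by rewrite lt_min ltr01 divr_gt0.
have [p hp] := uP L _ _ d2 e3; have [q hq] := vP L _ _ d2 e3.
exists (p * q); have := mostlyI hp hq; rewrite -splitr.
move=> m; apply: mostlyS m _ => x _ [].
rewrite !le_min => /andP[_ h1] /andP[h2 h3].
have -> : u x * v x - (p * q).[x] = u x * (v x - q.[x]) + (u x - p.[x]) * q.[x].
  by rewrite hornerM; ring.
apply: le_trans (ler_normD _ _) _; rewrite !normrM.
have q2 : `|q.[x]| <= 2.
  have := ler_normB (v x) (v x - q.[x]); rewrite subKr; have := v1 x; lra.
have a1 : `|u x| * `|v x - q.[x]| <= 1 * (e / 3) by apply: ler_pM.
have a2 : `|u x - p.[x]| * `|q.[x]| <= e / 3 * 2 by apply: ler_pM.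
by lra.
Qed.

Lemma bernoulli_ineq (y : R) n : -1 <= y -> 1 + n%:R * y <= (1 + y) ^+ n.
Proof.
move=> y1; elim: n => [|n IH]; first by rewrite expr0 mul0r addr0.
have n0 : 0 <= n%:R :> R by [].
have y2 : 0 <= n%:R * (y * y) by rewrite mulr_ge0// -expr2 sqr_ge0.
rewrite exprS -natr1; apply: le_trans (_ : _ <= (1 + y) * (1 + n%:R * y)) _.
  by lra.
by rewrite ler_wpM2l//; lra.
Qed.

Lemma geometric_small (t e : R) : 0 <= t < 1 -> 0 < e -> exists n, t ^+ n <= e.
Proof.
move=> /andP[t0 t1] e0.
have h : (fun n => t ^+ n) @ \oo --> (0 : R) by apply: cvg_expr; rewrite ger0_norm.
have /cvgrPdist_le/(_ e e0)[n _ /(_ n (leqnn n))] := h.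
by rewrite sub0r normrN ger0_norm ?exprn_ge0// => ?; exists n.
Qed.

(* The polynomials of Stone's proof of the Weierstrass theorem. *)
Lemma stone_step (r e : R) : 0 < r < 1 / 2 -> 0 < e -> exists n, forall t,
  (0 <= t <= 1 / 2 - r -> `|1 - (1 - t ^+ n) ^+ (2 ^ n)| <= e) /\
  (1 / 2 + r <= t <= 1 -> `|(1 - t ^+ n) ^+ (2 ^ n)| <= e).
Proof.
move=> /andP[r0 r1] e0.
(* The errors are at most [(2 * t) ^+ n] on the left and its inverse on the right of [1 / 2]. *)
have [n1 hn1] := @geometric_small (1 - 2 * r) e ltac:(lra) e0.
have [n2 hn2] := @geometric_small (1 / (1 + 2 * r)) e
  ltac:(apply/andP; split; [rewrite divr_ge0//; lra|rewrite ltr_pdivrMr; lra]) e0.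
pose n := maxn n1 n2.
have mono (s : R) m : 0 <= s <= 1 -> (m <= n)%N -> s ^+ m <= e -> s ^+ n <= e.
  move=> /andP[s0 s1] mn; apply: le_trans; exact: ler_wiXn2l.
have {}hn1 : (1 - 2 * r) ^+ n <= e by apply: mono hn1; [lra|exact: leq_maxl].
have {}hn2 : (1 / (1 + 2 * r)) ^+ n <= e.
  apply: mono hn2; last exact: leq_maxr.
  by apply/andP; split; [rewrite divr_ge0//; lra|rewrite ler_pdivrMr; lra].
exists n => t; split=> /andP[ta tb].
  have tn : 0 <= t ^+ n by rewrite exprn_ge0.
  have tn1 : t ^+ n <= 1 by rewrite exprn_ile1//; lra.
  have b0 : 0 <= 1 - t ^+ n by lra.
  have le1 : (1 - t ^+ n) ^+ (2 ^ n) <= 1 by rewrite exprn_ile1//; lra.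
  rewrite ger0_norm; last by lra.
  have := @bernoulli_ineq (- t ^+ n) (2 ^ n); rewrite natrX => /(_ ltac:(lra)).
  rewrite mulrN -exprMn => h; apply: le_trans hn1.
  apply: (@le_trans _ _ ((2 * t) ^+ n)); first by lra.
  by rewrite lerXn2r ?nnegrE; lra.
have t0 : 0 < t by lra.
have tn : 0 <= t ^+ n by rewrite exprn_ge0// ltW.
have tn1 : t ^+ n <= 1 by rewrite exprn_ile1//; lra.
have b0 : 0 <= 1 - t ^+ n by lra.
rewrite ger0_norm ?exprn_ge0//; apply: le_trans hn2.
have t2 : 0 < (2 * t) ^+ n by rewrite exprn_gt0//; lra.
(* This product turns Bernoulli's lower bound for the second factor into an upper bound for the
   first. *)
have k1 : (1 - t ^+ n) ^+ (2 ^ n) * (1 + t ^+ n) ^+ (2 ^ n) <= 1.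
  rewrite -exprMn exprn_ile1//; last by nra.
  by rewrite mulr_ge0//; lra.
have k2 : (2 * t) ^+ n <= (1 + t ^+ n) ^+ (2 ^ n).
  have := @bernoulli_ineq (t ^+ n) (2 ^ n); rewrite natrX exprMn => /(_ ltac:(lra)).
  by lra.
have k3 : (1 - t ^+ n) ^+ (2 ^ n) * (2 * t) ^+ n <= 1.
  by apply: le_trans k1; rewrite ler_wpM2l// exprn_ge0.
apply: (@le_trans _ _ ((2 * t) ^+ n)^-1).
  by rewrite -[leRHS]mul1r ler_pdivlMr.
rewrite -exprVn lerXn2r ?nnegrE ?invr_ge0 ?divr_ge0//; try lra.
by rewrite mul1r lef_pV2 ?posrE; lra.
Qed.

(** The affine [q] maps the interval of radius [M] around [a] onto [[0, 1]] and [a] to [1 / 2]. The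
    jump is avoided by a ball of radius [d / 2], which becomes the margin [d / (4 * M)] in
    [stone_step]. *)
Lemma polymost_le (a : R) : polymost (fun x => (x <= a)%R%:R).
Proof.
move=> L d e d0 e0.
pose M := `|L| + `|a| + d + 1.
have L0 := ler_norm L; have a0 := ler_norm a; have aN := ler_norm (- a).
rewrite normrN in aN.
have M0 : 0 < M by rewrite /M; have := normr_ge0 L; have := normr_ge0 a; lra.
have r01 : 0 < d / (4 * M) < 1 / 2.
  rewrite divr_gt0 ?mulr_gt0//= ltr_pdivrMr ?mulr_gt0//.
  rewrite /M; have := normr_ge0 L; have := normr_ge0 a; lra.
have [n hn] := stone_step r01 e0.
pose q : {poly R} := (2 * M)^-1 *: ('X - a%:P) + (1 / 2)%:P.
exists ((1 - q ^+ n) ^+ (2 ^ n)).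
apply: (@le_trans _ _ (mu (ball a (d / 2)))); last first.
  by rewrite lebesgue_measure_ball; [rewrite lee_fin mulr2n -splitr|rewrite divr_ge0 ?(ltW d0)].
apply: lebesgue_le => x [/= xL]; apply: contra_notP => xa.
have {}xa : d / 2 <= `|a - x| by rewrite leNgt; exact/negP.
rewrite !(hornerE, horner_exp) /=.
set t := (2 * M)^-1 * (x - a) + 2^-1.
have xa0 := ler_norm (x - a); have xaN := ler_norm (- (x - a)).
have xaM : `|x - a| <= M.
  by apply: le_trans (ler_normB _ _) _; rewrite /M; lra.
rewrite normrN in xaN.
have tE : t - 1 / 2 = (x - a) / (2 * M) by rewrite /t div1r addrK mulrC.
have rE : d / (4 * M) = d / 2 / (2 * M) by field; rewrite gt_eqF.
have M2 : 0 < 2 * M by rewrite mulr_gt0.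
have hM : M / (2 * M) = 1 / 2 by field; rewrite gt_eqF.
have [h1 h2] := hn t.
have [xlea|xgta] := leP x a.
  apply: h1; move: xa; rewrite ger0_norm ?subr_ge0// => xa.
  have : - M / (2 * M) <= (x - a) / (2 * M) by rewrite ler_pM2r ?invr_gt0//; lra.
  have : (x - a) / (2 * M) <= - (d / 2) / (2 * M) by rewrite ler_pM2r ?invr_gt0//; lra.
  by rewrite !mulNr hM -rE; lra.
rewrite sub0r normrN; apply: h2; move: xa; rewrite distrC gtr0_norm ?subr_gt0// => xa.
have : (x - a) / (2 * M) <= M / (2 * M) by rewrite ler_pM2r ?invr_gt0//; lra.
have : d / 2 / (2 * M) <= (x - a) / (2 * M) by rewrite ler_pM2r ?invr_gt0//; lra.
by rewrite hM -rE; lra.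
Qed.

End PolynomialDensity.

(** * Polynomial approximation in measure: measurable sets and functions *)

Section MeasurableDensity.
Context {R : realType}.
Implicit Types (u v : R -> R) (A B : set R) (L d e : R).
Notation mu := (@lebesgue_measure R).
Notation caratheodory := ((@wlength R idfun)^*%mu.-cara.-measurable).

Lemma eq_polymost u v : u =1 v -> polymost u -> polymost v.
Proof. by move=> /funext ->. Qed.

Lemma norm_indic_le1 A (x : R) : `|\1_A x : R| <= 1.
Proof. by rewrite indicE normr_nat lern1 leq_b1. Qed.

Lemma polymost_setC A : polymost \1_A -> polymost \1_(~` A).
Proof.
move=> hA; apply: eq_polymost (polymostD (polymost_horner 1%:P) (polymostZ (-1) hA)) => x.
by rewrite hornerC !indicE in_setC; case: (x \in A); rewrite /= ?mulr1 ?mulr0 ?subrr ?addr0.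
Qed.

Lemma polymost_setI A B : polymost \1_A -> polymost \1_B -> polymost \1_(A `&` B).
Proof.
move=> hA hB; apply: eq_polymost (polymostM (norm_indic_le1 A) (norm_indic_le1 B) hA hB) => x.
by rewrite !indicE in_setI -natrM mulnb.
Qed.

Lemma polymost_setU A B : polymost \1_A -> polymost \1_B -> polymost \1_(A `|` B).
Proof.
move=> hA hB; rewrite -[A `|` B]setCK setCU.
by apply/polymost_setC/polymost_setI; exact: polymost_setC.
Qed.

Lemma polymost_set0 : polymost \1_(@set0 R).
Proof.
apply: eq_polymost (polymost_horner 0%:P) => x.
by rewrite hornerC indicE in_set0.
Qed.

Lemma polymost_ocitv (a b : R) : polymost \1_(`]a, b]%classic).
Proof.
have ray (c : R) : polymost \1_[set x : R | x <= c].
  apply: eq_polymost (polymost_le c) => x; rewrite indicE.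
  by congr ((nat_of_bool _)%:R); apply/idP/idP; rewrite inE.
rewrite (_ : `]a, b]%classic = [set x | x <= b] `&` ~` [set x | x <= a]); last first.
  apply/seteqP; split => x /=; rewrite in_itv /=.
    by move=> /andP[ax xb]; split => //; apply/negP; rewrite -ltNge.
  by move=> [xb /negP]; rewrite -ltNge => ->.
by apply: polymost_setI => //; exact: polymost_setC.
Qed.

Lemma lebesgue_lt_pinfty L A : A `<=` [set x : R | `|x| <= L] -> (mu A < +oo)%E.
Proof.
move=> AL; apply: (@le_lt_trans _ _ (mu (ball (0 : R) (`|L| + 1)))).
  apply: lebesgue_le => x /AL /= xL; rewrite /ball /= sub0r normrN.
  by rewrite (le_lt_trans xL)// (le_lt_trans (ler_norm L))// ltrDl.
by rewrite lebesgue_measure_ball ?addr_ge0// ltry.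
Qed.

(** The part of [A] in [[-L, L]] is covered by intervals of nearly minimal total length. The excess
    of the cover and the tail beyond finitely many intervals each cost [d / 2]; a finite union of
    intervals is already treated. *)
Lemma polymost_caratheodory A : caratheodory A -> polymost \1_A.
Proof.
move=> mA; apply: polymost_lim => L d e d0 e0.
pose B := [set x : R | `|x| <= L].
have AB : mu (A `&` B) \is a fin_num.
  rewrite ge0_fin_numE ?outer_measure_ge0//.
  by apply: (@lebesgue_lt_pinfty L); exact: subIsetr.
have d4 : 0 < d / 2 by rewrite divr_gt0.
have [_ [F [mF AF] <-] hF] := lb_ereal_inf_adherent d4 AB.
have F0 k : (0 <= wlength idfun (F k))%E by exact: measure_ge0.
have muF k : mu (F k) = wlength idfun (F k).
  by rewrite -[mu _]/((wlength idfun)^*%mu (F k)) measurable_mu_extE.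
pose U := \bigcup_k F k.
pose X := U `&` B.
have muU : (mu U <= \sum_(0 <= k <oo) wlength idfun (F k))%E.
  apply: le_trans (lebesgue_bigcup F) _.
  by rewrite (eq_eseriesr (fun k _ => muF k)).
(* Caratheodory's criterion for [A], tested on [X], bounds the excess; finiteness of the measure
   allows the cancellation. *)
have XA : (mu (X `&` ~` A) <= (d / 2)%:E)%E.
  have XAE : X `&` A = A `&` B.
    apply/seteqP; split => x [] => [[_ xB] xA|xA xB]; split => //.
    by split => //; exact: AF.
  have h := mA X; rewrite XAE in h.
  have : (mu (A `&` B) + mu (X `&` ~` A) <= mu (A `&` B) + (d / 2)%:E)%E.
    rewrite -[leLHS]h; apply: le_trans (ltW hF); apply: le_trans muU.
    by apply: lebesgue_le => x [].
  by rewrite leeD2lE.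
have sum_fin : (\sum_(0 <= k <oo) wlength idfun (F k) < +oo)%E.
  apply: lt_trans hF _; apply: lte_add_pinfty; last exact: ltry.
  by apply: (@lebesgue_lt_pinfty L); exact: subIsetr.
have [K hK] : exists K, (\sum_(K <= k <oo) wlength idfun (F k) <= (d / 2)%:E)%E.
  have := nneseries_tail_cvg sum_fin (fun k _ => F0 k).
  move=> /fine_cvgP[fin /cvgrPdist_le/(_ _ d4) hd].
  have [K _ hK] := filterI fin hd.
  exists K; have [fK] := hK K (leqnn K).
  by rewrite /= sub0r normrN => dK; rewrite -(fineK fK) lee_fin (le_trans (ler_norm _)).
exists \1_(\big[setU/set0]_(i < K) F i); split.
  elim/big_ind: _ => [|V W|i _]; [exact: polymost_set0|exact: polymost_setU|].
  by have [[a b] _ <-] := mF i; exact: polymost_ocitv.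
pose T := \bigcup_(k in ~` `I_K) F k.
have muT : (mu T <= (d / 2)%:E)%E.
  apply: le_trans (outer_measure_sigma_subadditive_tail (wlength idfun)^*%mu K F) _.
  apply: le_trans hK; rewrite le_eqVlt; apply/orP; left; apply/eqP.
  exact: (eq_eseriesr (fun k _ => muF k)).
rewrite /mostly [d]splitr EFinD; apply: le_trans (leeD XA muT).
apply: le_trans (lebesgueU2 _ _); apply: lebesgue_le => x [/= xL].
apply: contra_notP => /not_orP[nXA nT].
suff -> : \1_A x = \1_(\big[setU/set0]_(i < K) F i) x :> R by rewrite subrr normr0 ltW.
rewrite !indicE; congr ((nat_of_bool _)%:R); apply/idP/idP; rewrite !inE -bigcup_mkord => hx.
  have [k _ Fk] := AF x (conj hx xL).
  exists k => //=; apply: contra_notP nT => kK; exists k => //=.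
case: hx => k /= kK Fk; apply: contra_notP nXA => nA; split => //; split => //.
by exists k.
Qed.

(* Layer cake: where [|u| <= J e], the function [u + J e] is within [e] of
   [e * sum_(j < 2J) 1_(u > (j - J) e)]. *)
Lemma polymost_measurable u :
  (forall a : R, caratheodory [set x | a < u x]) -> polymost u.
Proof.
move=> um; apply: polymost_lim => L d e d0 e0.
pose B := [set x : R | `|x| <= L].
have mB : caratheodory B.
  have -> : B = `[- L, L]%classic.
    by apply/seteqP; split => x; rewrite /B /= in_itv /= ler_norml.
  apply: sub_caratheodory; exact: (@measurable_itv R `[- L, L]).
(* These sets decrease to the empty set inside the bounded [B], so some [E J] has measure at most
   [d]. *)
pose E J := B `&` ([set x | J%:R * e < u x] `|` ~` [set x | - (J%:R * e) < u x]).
have mE J : caratheodory (E J).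
  apply: (@measurableI _ (lebesgueType R)) => //.
  apply: (@measurableU _ (lebesgueType R)); first exact: um.
  by apply: (@measurableC _ (lebesgueType R)); exact: um.
have [J hJ] : exists J, (mu (E J) <= d%:E)%E.
  have cv := @nonincreasing_cvg_mu _ (lebesgueType R) R (@completed_lebesgue_measure R) E.
  have e00 : \bigcap_J E J = set0.
    rewrite -subset0 => x h; have := h (Num.bound (`|u x| / e)) I => -[_] /=.
    have : `|u x| < (Num.bound (`|u x| / e))%:R * e.
      by rewrite -ltr_pdivrMr// unstable.ltr_bound.
    by rewrite ltr_norml => /andP[h1 h2] [h3|]; [move: (lt_trans h2 h3); rewrite ltxx|].
  have /fine_cvgP[fin /cvgrPdist_le/(_ _ d0) hd] : completed_lebesgue_measure (E n) @[n --> \oo] --> 0%E.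
    have := cv _ mE _ _; rewrite e00 measure0; apply.
    - by apply: (@lebesgue_lt_pinfty L); exact: subIsetl.
    - exact: measurable0.
    - apply/nonincreasing_seqP => n; rewrite subsetEset => x [xB [h|h]]; split => //.
        by left; apply: le_lt_trans h; rewrite ler_wpM2r ?(ltW e0)// ler_nat.
      right; apply: contra_not h => h /=; apply: le_lt_trans h.
      by rewrite lerN2 ler_wpM2r ?(ltW e0)// ler_nat.
  have [K _ hK] := filterI fin hd.
  exists K; have [fK] := hK K (leqnn K).
  rewrite /= sub0r normrN => dK; rewrite -[mu _]/(completed_lebesgue_measure (E K)).
  by rewrite -(fineK fK) lee_fin (le_trans (ler_norm _)).
pose lev (j : nat) : set R := [set x | (j%:R - J%:R) * e < u x].
pose v x := e * \sum_(j < J.*2) \1_(lev j) x - J%:R * e.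
exists v; split.
  rewrite /v; apply: eq_polymost (polymostD (polymostZ e _) (polymost_horner (- (J%:R * e))%:P)).
    by move=> x; rewrite hornerC.
  elim: J.*2 => [|m IH]; first by apply: eq_polymost polymost_set0 => x; rewrite big_ord0 indicE in_set0.
  apply: eq_polymost (polymostD IH (polymost_caratheodory (um ((m%:R - J%:R) * e)))) => x.
  by rewrite big_ord_recr.
apply: le_trans hJ; apply: lebesgue_le => x [/= xL]; apply: contra_notP => nE.
have [uJ1 uJ2] : u x <= J%:R * e /\ - (J%:R * e) < u x.
  split; first by rewrite leNgt; apply/negP => h; apply: nE; split => //; left.
  by apply: contra_notP nE => h; split => //; right.
pose y := u x + J%:R * e.
have y0 : 0 < y by rewrite /y; lra.
(* As long as [m * e < y] every level counts; once [y] is reached the sum no longer changes. *)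
have key m : (y <= m%:R * e -> y - e <= e * \sum_(j < m) \1_(lev j) x <= y + e) /\
    (m%:R * e < y -> e * \sum_(j < m) \1_(lev j) x = m%:R * e).
  elim: m => [|m [IH1 IH2]].
    by rewrite big_ord0 mul0r mulr0; split => // h; lra.
  rewrite big_ord_recr /= mulrDr indicE.
  have levE : (x \in lev m) = (m%:R * e < y).
    apply/idP/idP; rewrite inE /lev /= /y mulrBl; lra.
  rewrite levE -natr1 mulrDl mul1r.
  have [h|h] := ltP (m%:R * e) y.
    by rewrite (IH2 h) /= mulr1; split => //; lra.
  rewrite /= mulr0 addr0; split => [_|]; first exact: IH1.
  by move=> h'; lra.
have := (key J.*2).1; rewrite -muln2 natrM => /(_ ltac:(rewrite /y; lra)).
rewrite /v muln2 ler_norml /y; lra.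
Qed.

End MeasurableDensity.

(** * Complex functions and rational polynomials *)

Section RationalDensity.
Local Open Scope complex_scope.
Context {R : realType}.
Implicit Types (f g : R -> R[i]).

Lemma polymost_continuous (u : R -> R) : continuous u -> polymost u.
Proof.
move=> cu; apply: polymost_measurable => a; apply: sub_caratheodory.
apply: (@measurable_realfun.open_measurable R); rewrite (_ : [set x | a < u x] = u @^-1` [set y | a < y])//.
by apply: open_comp => // x _; exact: cu.
Qed.

Lemma polymost_Re_lebesgue_measurable f : lebesgue_measurable f ->
  polymost (fun x => complex.Re (f x)).
Proof.
move=> fm; apply: polymost_measurable => a.
have o : open [set z : R[i]^o | a < complex.Re z].
  rewrite openE => z /= az; apply/nbhs_ballP; exists (complex.Re z - a)%:C => /=.
    by rewrite ltcR subr_gt0.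
  move=> w; rewrite -ball_normE /= => zw.
  have h : cabs (z - w) < complex.Re z - a by rewrite -ltcR -cabsE; exact: zw.
  have := Re_le_cabs (z - w); rewrite raddfB /= ler_norml => /andP[_]; lra.
have mo : @measurable _ (borelC R) [set z : R[i]^o | a < complex.Re z].
  exact: sub_sigma_algebra.
by have := fm measurableT _ mo; rewrite setTI.
Qed.

Lemma polymost_Im_lebesgue_measurable f : lebesgue_measurable f ->
  polymost (fun x => complex.Im (f x)).
Proof.
move=> fm; apply: polymost_measurable => a.
have o : open [set z : R[i]^o | a < complex.Im z].
  rewrite openE => z /= az; apply/nbhs_ballP; exists (complex.Im z - a)%:C => /=.
    by rewrite ltcR subr_gt0.
  move=> w; rewrite -ball_normE /= => zw.
  have h : cabs (z - w) < complex.Im z - a by rewrite -ltcR -cabsE; exact: zw.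
  have := Im_le_cabs (z - w); rewrite raddfB /= ler_norml => /andP[_]; lra.
have mo : @measurable _ (borelC R) [set z : R[i]^o | a < complex.Im z].
  exact: sub_sigma_algebra.
by have := fm measurableT _ mo; rewrite setTI.
Qed.

(** The class used for the residuals: it contains the measurable functions and the exponential sums,
    and it is stable under linear combinations. *)
Definition cpolymost f : Prop :=
  polymost (fun x => complex.Re (f x)) /\ polymost (fun x => complex.Im (f x)).

Lemma cpolymost_lebesgue_measurable f : lebesgue_measurable f -> cpolymost f.
Proof.
by split; [exact: polymost_Re_lebesgue_measurable|exact: polymost_Im_lebesgue_measurable].
Qed.

Lemma cpolymostD f g : cpolymost f -> cpolymost g -> cpolymost (fun x => f x + g x).
Proof.
move=> [f1 f2] [g1 g2]; split.
  by apply: eq_polymost (polymostD f1 g1) => x; rewrite raddfD.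
by apply: eq_polymost (polymostD f2 g2) => x; rewrite raddfD.
Qed.

Lemma cpolymostZ (a : R[i]) f : cpolymost f -> cpolymost (fun x => a * f x).
Proof.
case: a => a b [f1 f2]; split.
  apply: eq_polymost (polymostD (polymostZ a f1) (polymostZ (- b) f2)) => x.
  by case: (f x) => c d /=; rewrite mulNr.
apply: eq_polymost (polymostD (polymostZ a f2) (polymostZ b f1)) => x.
by case: (f x) => c d.
Qed.

Lemma cpolymost_expi (a : R) : cpolymost (fun x => expi (a * x)).
Proof.
split; apply: polymost_continuous => x /=.
  apply: (@continuous_comp _ _ _ (fun y => a * y) cos); last exact: continuous_cos.
  exact: mulrl_continuous.
apply: (@continuous_comp _ _ _ (fun y => a * y) sin); last exact: continuous_sin.
exact: mulrl_continuous.
Qed.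

Lemma cpolymost_tsum (rho : nat -> R) T : cpolymost (tsum rho T).
Proof.
elim: T => [|t T IH].
  split; apply: eq_polymost (polymost_horner 0) => x; by rewrite horner0 /tsum /psum big_nil.
have -> : tsum rho (t :: T) = (fun x => tval rho t x + tsum rho T x).
  by apply/funext => x; rewrite /tsum /psum big_cons.
by apply: cpolymostD => //; apply: cpolymostZ; exact: cpolymost_expi.
Qed.

Definition ratpoly_fun (q : {poly rat} * {poly rat}) (x : R) : R[i] :=
  (map_poly ratr q.1).[x] +i* (map_poly ratr q.2).[x].

Lemma rat_dense (x e : R) : 0 < e -> exists q : rat, `|x - ratr q| <= e.
Proof.
move=> e0; have [|q] := @rat_in_itvoo R (x - e) (x + e); first by lra.
by rewrite in_itv /= => /andP[h1 h2]; exists q; rewrite ler_norml; lra.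
Qed.

Lemma ratpoly_dense (p : {poly R}) (L e : R) : 0 < e -> exists q : {poly rat},
  forall x, `|x| <= L -> `|p.[x] - (map_poly ratr q).[x]| <= e.
Proof.
elim/poly_ind: p e => [|p c IH] e e0.
  by exists 0 => x _; rewrite rmorph0 horner0 subrr normr0 ltW.
have M0 : 0 < 2 * (`|L| + 1) by rewrite mulr_gt0// ltr_wpDl.
have [|q hq] := IH (e / (2 * (`|L| + 1))); first by rewrite divr_gt0.
have [|r hr] := @rat_dense c (e / 2); first by rewrite divr_gt0.
exists (q * 'X + r%:P) => x xL; rewrite rmorphD rmorphM /= map_polyX map_polyC /=.
rewrite !hornerE opprD addrACA -mulrBl; apply: le_trans (ler_normD _ _) _.
rewrite [leRHS]splitr; apply: lerD => //; rewrite normrM.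
apply: (@le_trans _ _ (e / (2 * (`|L| + 1)) * (`|L| + 1))).
  by apply: ler_pM => //; [exact: hq|rewrite (le_trans xL)// (le_trans (ler_norm L))// lerDl].
by rewrite le_eqVlt; apply/orP; left; apply/eqP; field; rewrite gt_eqF// ltr_wpDl.
Qed.

Lemma cpolymost_ratpoly f (L d e : R) : cpolymost f -> 0 < d -> 0 < e ->
  exists q, mostly L d (fun x => cabs (f x - ratpoly_fun q x) <= e).
Proof.
move=> [f1 f2] d0 e0.
have d2 : 0 < d / 2 by rewrite divr_gt0.
have e4 : 0 < e / 4 by rewrite divr_gt0.
have [p1 hp1] := f1 L _ _ d2 e4; have [p2 hp2] := f2 L _ _ d2 e4.
have [q1 hq1] := ratpoly_dense p1 L e4; have [q2 hq2] := ratpoly_dense p2 L e4.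
exists (q1, q2); have := mostlyI hp1 hp2; rewrite -splitr => m; apply: mostlyS m _.
move=> x xL [h1 h2]; have := hq1 x xL; have := hq2 x xL => h3 h4.
rewrite /ratpoly_fun /=; case: (f x) h1 h2 => a b /= h1 h2.
apply: le_trans (cabs_le_ReIm _ _) _.
have := ler_distD p1.[x] a (map_poly ratr q1).[x].
have := ler_distD p2.[x] b (map_poly ratr q2).[x].
by lra.
Qed.

Lemma spanned_ratpoly (rho : nat -> R) k q : (forall k, rho k != 0) ->
  rho @ \oo --> (0 : R) -> spanned rho k (ratpoly_fun q).
Proof.
move=> r0 rc.
have S (p : {poly rat}) : spanned rho k (fun x => ((map_poly ratr p).[x])%:C).
  apply: eq_spanned (spanned_poly r0 rc k (map_poly (real_complex R) (map_poly ratr p))) => x.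
  by rewrite horner_map.
apply: eq_spanned (spannedD (S q.1) (spannedZ 'i (S q.2))) => x.
by rewrite /ratpoly_fun; apply/eqP; rewrite eq_complex /=; rewrite !(mul0r, mul1r, mulr0, add0r, addr0, subr0) !eqxx.
Qed.

End RationalDensity.

(** * From outer measure to almost everywhere *)

Section AlmostEverywhere.
Context {R : realType}.
Notation mu := (@lebesgue_measure R).

(** Negligibility asks for a Borel null cover. An outer null set is Caratheodory measurable, hence
    the union of a Borel set, again null, and a negligible one. *)
Lemma lebesgue_null_negligible (Z : set R) : mu Z = 0%E -> mu.-negligible Z.
Proof.
move=> Z0.
have cZ : ((@wlength R idfun)^*%mu.-cara.-measurable) Z.
  apply: le_caratheodory_measurable => X.
  rewrite [X in (X + _ <= _)%E](_ : _ = 0%E); last first.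
    apply/eqP; rewrite eq_le outer_measure_ge0 andbT -Z0.
    by apply: le_outer_measure; exact: subIsetr.
  by rewrite add0e; apply: le_outer_measure; exact: subIsetl.
move: cZ; rewrite -completed_caratheodory_measurable g_sigma_completed_algebra_genE.
move=> [X mX [N nN XN]]; rewrite -XN; apply: negligibleU => //.
exists X; split => //; apply/eqP; rewrite eq_le measure_ge0 andbT -Z0.
by apply: lebesgue_le; rewrite -XN; exact: subsetUl.
Qed.

(** The window [|x| <= i] grows with [i], so every [x] is eventually inside, and the exceptional
    measures have a finite sum. *)
Lemma borel_cantelli_mostly (P : nat -> R -> Prop) :
  (forall i, mostly i%:R (1 / (2 ^ i.+1)%:R) (P i)) ->
  {ae mu, forall x, exists n, forall i, (n <= i)%N -> P i x}.
Proof.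
move=> hP; pose B i := [set x : R | `|x| <= i%:R /\ ~ P i x].
have B0 i : (0 <= mu (B i))%E by exact: outer_measure_ge0.
have sB : (\sum_(0 <= i <oo) mu (B i) < +oo)%E.
  apply: (@le_lt_trans _ _ 1%E); last exact: ltry.
  apply: le_trans (epsilon_trick0 xpredT (ler01 : 0 <= 1 :> R)).
  by apply: lee_nneseries => // i _; exact: hP.
pose Z := \bigcap_n \bigcup_(i in ~` `I_n) B i.
have Z0 : mu Z = 0%E.
  apply/eqP; rewrite eq_le outer_measure_ge0 andbT; apply/lee_addgt0Pr => e e0.
  have /fine_cvgP[fin /cvgrPdist_le/(_ _ e0) hd] := nneseries_tail_cvg sB (fun k _ => B0 k).
  have [K _ hK] := filterI fin hd; have [fK] := hK K (leqnn K).
  rewrite /= sub0r normrN add0e => dK.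
  apply: (@le_trans _ _ (\sum_(K <= i <oo) mu (B i))%E); last first.
    by rewrite -(fineK fK) lee_fin (le_trans (ler_norm _)).
  apply: le_trans (outer_measure_sigma_subadditive_tail (wlength idfun)^*%mu K B).
  by apply: lebesgue_le => x /(_ K I).
apply: negligibleS (lebesgue_null_negligible Z0) => x /= nx n _.
apply: contra_notP nx => nB; exists (maxn n (Num.bound `|x|)) => i.
rewrite geq_max => /andP[ni xi]; apply: contra_notP nB => nP.
exists i => /=; first by apply/negP; rewrite -leqNgt.
split => //; apply/ltW/(lt_le_trans (unstable.ltr_bound _)).
by rewrite ler_nat.
Qed.

End AlmostEverywhere.

(** * The sequence of stages *)

Section SpectrumData.
Context {R : realType} (rho : nat -> R).
Hypotheses (rho_neq0 : forall k, rho k != 0) (rho_cvg : rho @ \oo --> (0 : R)).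
Variable (K0 : nat).

Definition stage_spec (C : R) (i : nat) (d : R) (T : seq term) (g : R -> R[i]) (e : R) : Prop :=
  mostly i%:R d (fun x => cabs (tsum rho T x - g x) <= e /\
    forall A, initial A -> cabs (psum rho T A x) <= C * cabs (g x) + e).

Lemma injective_unbounded (h : nat -> nat) : injective h -> forall S, exists m, (S <= h m)%N.
Proof.
move=> hI S; apply: contrapT => /forallNP hS.
have := @uniq_leq_size _ (map h (iota 0 S.+1)) (iota 0 S).
rewrite map_inj_uniq// iota_uniq size_map !size_iota ltnn => /(_ isT) hsub.
suff : false by [].
apply: hsub => _ /mapP[m _ ->].
by rewrite mem_iota /= add0n ltnNge; apply/negP; exact: hS.
Qed.

(* Every triple (rational polynomial, [i], [m]) is the code of one stage [s], so
   that each target is met at precision [2^-m] by infinitely many stages. *)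
Lemma spectrum_data : exists (C : nat -> R) (N : nat -> nat) (l : nat -> seq term),
  [/\ forall i, 0 <= C i,
      N 0%N = 0%N /\ forall s, (N s < N s.+1)%N,
      forall s, good (N s) (s + K0) (l s),
      forall s, {in l s, forall t : term, (`|t.1.1| < N s.+1)%N} &
      forall i q (e : R) S, 0 < e -> exists2 s, (S <= s)%N &
        stage_spec (C i) i (1 / (2 ^ i.+1)%:R / 2) (l s) (ratpoly_fun q) e].
Proof.
have d0 i : 0 < 1 / (2 ^ i.+1)%:R / 2 :> R by rewrite !divr_gt0// ltr0n expn_gt0.
have hC i : exists C, 0 <= C /\ forall k g, spanned rho k g -> forall e N, 0 < e ->
    exists T, good N k T /\ stage_spec C i (1 / (2 ^ i.+1)%:R / 2) T g e.
  have [C C0 CP] := spanned_stage rho i%:R (d0 i).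
  exists C; split => [//|k g gS e N e0].
  by have [T [? ?]] := CP k g gS e N e0; exists T.
have [C hC'] := choice hC.
(* A number that codes no triple gets the empty stage. Perturbation indices start at [s + K0]: [s]
   serves the finiteness of repetitions, [K0] the size of the perturbations. *)
have hF (sN : nat * nat) : exists T, good sN.2 (sN.1 + K0) T /\
    forall q i m, unpickle sN.1 = Some (q, i, m) ->
    stage_spec (C i) i (1 / (2 ^ i.+1)%:R / 2) T (ratpoly_fun q) ((1 / 2) ^+ m).
  case: sN => s N /=.
  case E : (unpickle s : option (({poly rat} * {poly rat}) * nat * nat)) => [[[q i] m]|].
    have [_ h] := hC' i.
    have [|T [gT hT]] := h (s + K0)%N _ (spanned_ratpoly (s + K0) q rho_neq0 rho_cvg) ((1 / 2) ^+ m) N.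
      by rewrite exprn_gt0.
    by exists T; split => // q' i' m' [<- <- <-].
  by exists [::]; split.
have [F hF'] := choice hF.
(* [N s.+1] exceeds all frequencies of stage [s], and stage [s] is built beyond [N s]. *)
pose N := fix N s := if s is s'.+1 then
  (maxn (N s') (\max_(t <- F (s', N s')) `|t.1.1|)%N).+1 else 0%N.
have NS s : N s.+1 = (maxn (N s) (\max_(t <- F (s, N s)) `|t.1.1|)%N).+1 by [].
exists C, N, (fun s => F (s, N s)); split.
- by move=> i; case: (hC' i).
- by split=> // s; rewrite NS ltnS leq_maxl.
- by move=> s; case: (hF' (s, N s)).
- move=> s t tF; rewrite NS ltnS leq_max; apply/orP; right.
  exact: (@leq_bigmax_seq _ (F (s, N s)) predT (fun t : term => absz t.1.1) t tF).
- move=> i q e S e0.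
  have [m0 hm0] := @geometric_small R (1 / 2) e ltac:(lra) e0.
  (* Raising the precision beyond [m0] produces codes, hence stages, as late as desired. *)
  have [|m hm] := @injective_unbounded (fun m => pickle (q, i, (m0 + m)%N)) _ S.
    by move=> m m' /(pcan_inj pickleK) [] /addnI.
  exists (pickle (q, i, (m0 + m)%N)) => //.
  have [_ /(_ _ _ _ (pickleK _)) h] := hF' (pickle (q, i, (m0 + m)%N), N (pickle (q, i, (m0 + m)%N))).
  apply: mostlyS h _ => x _ [h1 h2].
  have em : (1 / 2) ^+ (m0 + m) <= e.
    rewrite exprD; apply: le_trans hm0; rewrite ler_piMr ?exprn_ge0//.
    by rewrite exprn_ile1 ?divr_ge0//; lra.
  split; first exact: le_trans em.
  by move=> A /h2 h3; apply: le_trans h3 _; rewrite lerD2l.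
Qed.

End SpectrumData.

(** * The spectrum and its perturbation indices *)

Section Spectrum.
Context {R : realType} (rho : nat -> R) (K0 : nat) (N : nat -> nat) (l : nat -> seq (@term R)).
Hypotheses (rho_le : forall k, (K0 <= k)%N -> `|rho k| <= 1 / 4)
  (N0 : N 0%N = 0%N) (N_lt : forall s, (N s < N s.+1)%N)
  (l_good : forall s, good (N s) (s + K0) (l s))
  (l_lt : forall s, {in l s, forall t : term, (`|t.1.1| < N s.+1)%N}).

Lemma N_le s s' : (s <= s')%N -> (N s <= N s')%N.
Proof. exact: (homo_leq leqnn leq_trans (fun i => ltnW (N_lt i))). Qed.

Lemma N_ge s : (s <= N s)%N.
Proof. by elim: s => // s IH; exact: leq_ltn_trans IH (N_lt s). Qed.

Lemma stage_index_ex (n : int) : exists s, (`|n| < N s.+1)%N.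
Proof. by exists `|n|%N; exact: N_ge. Qed.

Definition stage_index (n : int) : nat := ex_minn (stage_index_ex n).

Lemma stage_indexP n : (N (stage_index n) <= `|n| < N (stage_index n).+1)%N.
Proof.
rewrite /stage_index; case: ex_minnP => s -> smin; rewrite andbT.
case: s smin => [|s] smin; first by rewrite N0.
by rewrite leqNgt; apply/negP => /smin; rewrite ltnn.
Qed.

Lemma stage_index_uniq n s : (N s <= `|n| < N s.+1)%N -> stage_index n = s.
Proof.
move=> /andP[s1 s2]; have /andP[i1 i2] := stage_indexP n.
apply/eqP; rewrite eqn_leq; apply/andP; split; rewrite leqNgt; apply/negP => /N_le h.
  by have := leq_trans s2 (leq_trans h i1); rewrite ltnn.
by have := leq_trans i2 (leq_trans h s1); rewrite ltnn.
Qed.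

Lemma term_bounds s t : t \in l s -> (N s < `|t.1.1| < N s.+1)%N.
Proof.
move=> ts; rewrite l_lt// andbT.
by have /andP[_ /allP/(_ t ts)/andP[]] := l_good s.
Qed.

Lemma stage_index_term s t : t \in l s -> stage_index t.1.1 = s.
Proof.
by move=> /term_bounds /andP[t1 t2]; apply: stage_index_uniq; rewrite t2 (ltnW t1).
Qed.

Lemma filter_term s t : t \in l s -> [seq u <- l s | u.1.1 == t.1.1] = [:: t].
Proof.
have /andP[+ _] := l_good s; elim: (l s) => //= u T IH /andP[uT uniqT].
rewrite inE => /predU1P[->|tT].
  rewrite eqxx; congr (_ :: _); apply/eqP; rewrite -size_eq0 size_filter -leqn0 leqNgt -has_count.
  by apply/negP => /hasP[v vT /eqP e]; move: uT; rewrite -e (map_f (fun t : term => t.1.1) vT).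
by case: eqP => [e|_]; [move: uT; rewrite e (map_f (fun t : term => t.1.1) tT)|exact: IH].
Qed.

(* Integers carrying no term of their stage still receive an index tending to
   infinity; they also make [kappa] surjective. *)
Definition kappa (n : int) : nat :=
  head (stage_index n) [seq t.1.2 | t <- l (stage_index n) & t.1.1 == n].

Definition amplitude (n : int) : R[i] :=
  head 0 [seq t.2 | t <- l (stage_index n) & t.1.1 == n].

Definition spectrum (n : int) : R := n%:~R + rho (kappa n).

Lemma kappa_term s t : t \in l s -> kappa t.1.1 = t.1.2.
Proof. by move=> ts; rewrite /kappa (stage_index_term ts) filter_term. Qed.

Lemma amplitude_term s t : t \in l s -> amplitude t.1.1 = t.2.
Proof. by move=> ts; rewrite /amplitude (stage_index_term ts) filter_term. Qed.

Lemma amplitude_neq0 n : amplitude n != 0 ->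
  exists2 t, t \in l (stage_index n) & t.1.1 = n.
Proof.
rewrite /amplitude; case E : [seq t <- l (stage_index n) | t.1.1 == n] => [|t T] /=; first by rewrite eqxx.
have : t \in [seq t <- l (stage_index n) | t.1.1 == n] by rewrite E mem_head.
by rewrite mem_filter => /andP[/eqP tn tl] _; exists t.
Qed.

(** This yields both the finiteness of the fibres of [kappa] and the decay of the perturbations. *)
Lemma kappa_ge n : (stage_index n <= kappa n)%N.
Proof.
rewrite /kappa; case E : [seq t <- l (stage_index n) | t.1.1 == n] => [|t T] //=.
have : t \in [seq t <- l (stage_index n) | t.1.1 == n] by rewrite E mem_head.
rewrite mem_filter => /andP[_ tl].
have /andP[_ /allP/(_ t tl)/andP[_]] := l_good (stage_index n).
by apply: leq_trans; rewrite leq_addr.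
Qed.

(** The integer [N k] lies in shell [k] but carries no term, as the terms lie strictly beyond [N k];
    so it receives the default index [k]. *)
Lemma kappa_surj k : exists n, kappa n = k.
Proof.
exists (N k)%:Z.
have e : stage_index (N k)%:Z = k by apply: stage_index_uniq; rewrite leqnn N_lt.
rewrite /kappa e; case E : [seq t <- l k | t.1.1 == (N k)%:Z] => [|t T] //=.
have : t \in [seq t <- l k | t.1.1 == (N k)%:Z] by rewrite E mem_head.
rewrite mem_filter => /andP[/eqP tn /term_bounds]; by rewrite tn ltnn.
Qed.

Lemma kappa_finite k : finite_set (kappa @^-1` [set k]).
Proof.
pose zs := [seq i%:Z | i <- iota 0 (N k.+1)] ++ [seq - i%:Z | i <- iota 0 (N k.+1)].
apply: (@sub_finite_set _ _ [set` zs]); last exact: finite_seq.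
move=> n /= kn; have /andP[_ nlt] := stage_indexP n.
have {}nlt : (`|n| < N k.+1)%N.
  by apply: leq_trans nlt _; apply: N_le; rewrite ltnS -kn kappa_ge.
rewrite mem_cat; apply/orP; case: (leP 0 n) => n0; [left|right]; apply/mapP.
  by exists `|n|%N; [rewrite mem_iota|rewrite gez0_abs].
by exists `|n|%N; [rewrite mem_iota|rewrite ltz0_abs// opprK].
Qed.

Lemma spectrum_asymp_int : rho @ \oo --> (0 : R) -> asymp_int spectrum.
Proof.
move=> rho_cvg e e0; have /cvgrPdist_lt/(_ e e0)[K _ hK] := rho_cvg.
exists (N K) => n nK; rewrite /spectrum addrAC subrr add0r.
have := hK (kappa n); rewrite sub0r normrN; apply => /=.
apply: leq_trans (kappa_ge n); rewrite leqNgt; apply/negP => h.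
have /andP[_ h2] := stage_indexP n.
by have := leq_trans h2 (leq_trans (N_le h) nK); rewrite ltnn.
Qed.

(** With perturbations this small, ordering terms by [|spectrum n|] agrees with ordering by [|n|],
    up to ties. Integers without a term may be perturbed more, but their amplitude is 0. *)
Lemma spectrum_term s t : t \in l s -> `|spectrum t.1.1 - t.1.1%:~R| <= 1 / 4.
Proof.
move=> ts; rewrite /spectrum addrAC subrr add0r (kappa_term ts); apply: rho_le.
have /andP[_ /allP/(_ t ts)/andP[_]] := l_good s.
by apply: leq_trans; rewrite leq_addl.
Qed.

(** * Partial sums for a selection of stages *)

Section Selection.
Variables (sel : nat -> nat).
Hypothesis sel_lt : forall i, (sel i < sel i.+1)%N.

(** The function to be represented enters only through [sel]; amplitudes and frequencies are fixed
    beforehand. *)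
Definition coef (n : int) : R[i] :=
  if `[< exists i, sel i = stage_index n >] then amplitude n else 0.

Lemma sel_le i j : (i <= j)%N -> (sel i <= sel j)%N.
Proof. exact: (homo_leq leqnn leq_trans (fun k => ltnW (sel_lt k))). Qed.

Lemma sel_ltn i j : (i < j)%N -> (sel i < sel j)%N.
Proof. by move=> ij; apply: leq_trans (sel_lt i) (sel_le ij). Qed.

Lemma sel_inj : injective sel.
Proof.
move=> i j e; apply/eqP; rewrite eqn_leq; apply/andP; split;
  by rewrite leqNgt; apply/negP => /sel_ltn; rewrite e ltnn.
Qed.

Lemma sel_ge i : (i <= sel i)%N.
Proof. by elim: i => // i IH; exact: leq_ltn_trans IH (sel_lt i). Qed.

Lemma symm_partial_sumE (x eta : R) J :
  (forall i, (J <= i)%N -> {in l (sel i), forall t, ~~ (`|spectrum t.1.1| < eta)}) ->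
  symm_partial_sum spectrum coef x eta =
  \sum_(i < J) psum rho (l (sel i)) (fun n => `|spectrum n| < eta) x.
Proof.
move=> hJ; pose layer i := [seq t.1.1 | t <- l (sel i) & `|spectrum t.1.1| < eta].
have mem_layer i n : n \in layer i -> exists2 t, t \in l (sel i) & n = t.1.1.
  by move=> /mapP[t]; rewrite mem_filter => /andP[_ tl] ->; exists t.
rewrite /symm_partial_sum (fsbigE (flatten [seq layer i | i <- iota 0 J])).
- rewrite big_flatten big_map.
  rewrite -[RHS](big_mkord xpredT (fun i => psum rho (l (sel i)) _ x)) /index_iota subn0.
  apply: eq_bigr => i _; rewrite /layer big_map big_filter_cond /psum.
  rewrite (eq_bigl (fun t : term => `|spectrum t.1.1| < eta)); last first.
    by move=> t; apply/andP/idP => [[]//|h]; split => //; rewrite inE.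
  rewrite big_seq_cond [RHS]big_seq_cond; apply: eq_bigr => t /andP[tl _].
  rewrite /tval /coef asboolT; last by exists i; rewrite (stage_index_term tl).
  by rewrite (amplitude_term tl) /spectrum (kappa_term tl).
- apply: uniq_flatten_map; first exact: iota_uniq.
  + move=> i _; have /andP[u _] := l_good (sel i).
    exact: subseq_uniq (map_subseq _ (filter_subseq _ _)) u.
  + move=> i j _ _ n /mem_layer[t tl ->] /mem_layer[t' tl' e].
    by apply: sel_inj; rewrite -(stage_index_term tl) e (stage_index_term tl').
- move=> n /flatten_mapP[i _ /mapP[t]].
  by rewrite mem_filter => /andP[h _] ->.
- move=> n /= nA nr; rewrite /coef; case: asboolP => [[i si]|_]; last by rewrite mul0r.
  have [->|/amplitude_neq0[t]] := eqVneq (amplitude n) 0; first by rewrite mul0r.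
  rewrite -si => tl tn; case/negP: nr; apply/flatten_mapP.
  have iJ : (i < J)%N.
    by rewrite ltnNge; apply/negP => /hJ/(_ t tl); rewrite tn nA.
  exists i; first by rewrite mem_iota.
  by apply/mapP; exists t => //; rewrite mem_filter tl tn nA.
Qed.

Lemma symm_partial_sum_split (x eta : R) : 0 < eta -> exists j A,
  [/\ initial A, forall n, (N (sel n).+1)%:R <= eta -> (n < j)%N &
   symm_partial_sum spectrum coef x eta =
     \sum_(i < j) tsum rho (l (sel i)) x + psum rho (l (sel j)) A x].
Proof.
move=> eta0.
(* By the bound [1 / 4], the cut at [eta] keeps all terms with [|n| < M] and none with [|n| > M]. *)
have [M M1 M2] : exists2 M : nat, M%:R <= eta + 1 / 4 & eta + 1 / 4 < M.+1%:R.
  have := @truncn_itv R (eta + 1 / 4) ltac:(lra) => /andP[h1 h2].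
  by exists (Num.Def.trunc (eta + 1 / 4)).
have up s t : t \in l s -> `|spectrum t.1.1| < eta -> (`|t.1.1| <= M)%N.
  move=> ts h; rewrite -ltnS -(ltr_nat R) natr_absz intr_norm.
  have := spectrum_term ts; have := ler_distD 0 (t.1.1%:~R : R) (spectrum t.1.1).
  have := lerB_dist (t.1.1%:~R : R) (spectrum t.1.1); rewrite distrC; lra.
have dn s t : t \in l s -> (`|t.1.1| < M)%N -> `|spectrum t.1.1| < eta.
  move=> ts; rewrite -(ler_nat R) -natr1 natr_absz intr_norm => h.
  have := spectrum_term ts; have := lerB_dist (spectrum t.1.1) (t.1.1%:~R : R); lra.
have ex : exists j, (M < N (sel j).+1)%N.
  by exists M; apply: leq_trans (N_ge _); rewrite ltnS sel_ge.
(* The first selected stage whose shell extends beyond [M]: the earlier ones are complete, the later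
   ones untouched. *)
have [j jM jmin] := ex_minnP ex.
(* The cut itself need not be initial at integers without a term; [A] is, and it agrees with the cut
   on terms. *)
pose A n := (`|n| < M)%N || (`|spectrum n| < eta) && (`|n| <= M)%N.
have AE s : psum rho (l s) (fun n => `|spectrum n| < eta) x = psum rho (l s) A x.
  rewrite /psum big_seq_cond [RHS]big_seq_cond; apply: eq_bigl => t.
  case: (boolP (t \in l s)) => //= ts; apply/idP/orP.
    by move=> h; right; rewrite h (up s).
  by case=> [/(dn s t ts)|/andP[]].
exists j, A; split.
- exists M; split => n; first by rewrite /A => ->.
  by move=> /orP[/ltnW|/andP[]].
- move=> n nN; rewrite ltnNge; apply/negP => jn.
  have : (N (sel j).+1)%:R <= eta by apply: le_trans nN; rewrite ler_nat N_le// ltnS sel_le.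
  move: jM; rewrite -(ler_nat R) => h1 h2; lra.
- rewrite (@symm_partial_sumE _ _ j.+1) => [|i ji t tl].
    rewrite big_ord_recr /= AE; congr (_ + _); apply: eq_bigr => i _.
    apply: psum_all => t tl; apply: (dn _ _ tl).
    have /andP[_ t2] := term_bounds tl; apply: leq_trans t2 _.
    by rewrite leqNgt; apply/negP => /jmin; rewrite leqNgt ltn_ord.
  apply/negP => /(up _ _ tl); have /andP[t1 _] := term_bounds tl.
  rewrite leqNgt => /negP; apply; apply: leq_ltn_trans t1; apply: ltnW.
  by apply: leq_trans jM _; apply: N_le; exact: sel_ltn.
Qed.

End Selection.
End Spectrum.

(** * Greedy selection and conclusion *)

Section UniversalSpectrum.
Context {R : realType}.

Lemma greedy_step (rho : nat -> R) (C : R) (i : nat) (d : R) (l : nat -> seq term)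
    (r : R -> R[i]) (e : R) (S : nat) : 0 <= C -> 0 < d -> 0 < e -> cpolymost r ->
  (forall q (e : R) S, 0 < e -> exists2 s, (S <= s)%N &
        stage_spec rho C i (d / 2) (l s) (ratpoly_fun q) e) ->
  exists2 s, (S <= s)%N & mostly i%:R d (fun x => cabs (r x - tsum rho (l s) x) <= e /\
    forall A, initial A -> cabs (psum rho (l s) A x) <= C * cabs (r x) + (C + 1) * e).
Proof.
move=> C0 d0 e0 cr hl.
have d2 : 0 < d / 2 by rewrite divr_gt0.
have e2 : 0 < e / 2 by rewrite divr_gt0.
have [q hq] := cpolymost_ratpoly i%:R cr d2 e2.
have [s Ss hs] := hl q _ S e2; exists s => //.
have := mostlyI hq hs; rewrite -splitr => m; apply: mostlyS m _.
move=> x _ [h1 [h2 h3]]; split.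
  by apply: le_trans (cabs_dist (ratpoly_fun q x) _ _) _; move: h2; rewrite cabs_distC; lra.
move=> A /h3 h; apply: le_trans h _.
have qr : cabs (ratpoly_fun q x) <= cabs (r x) + e / 2.
  have := cabsB (r x) (r x - ratpoly_fun q x); rewrite opprB addrC subrK; lra.
have : C * cabs (ratpoly_fun q x) <= C * (cabs (r x) + e / 2) by rewrite ler_wpM2l.
have : 0 <= C * e by rewrite mulr_ge0// ltW.
lra.
Qed.

Lemma universal_spectrumP (rho : nat -> R) (K0 : nat) (N : nat -> nat)
    (l : nat -> seq (@term R)) (N_lt : forall s, (N s < N s.+1)%N) (C : nat -> R) :
  (forall k, (K0 <= k)%N -> `|rho k| <= 1 / 4) -> N 0%N = 0%N ->
  (forall s, good (N s) (s + K0) (l s)) ->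
  (forall s, {in l s, forall t : term, (`|t.1.1| < N s.+1)%N}) ->
  (forall i, 0 <= C i) ->
  (forall i q (e : R) S, 0 < e -> exists2 s, (S <= s)%N &
        stage_spec rho (C i) i (1 / (2 ^ i.+1)%:R / 2) (l s) (ratpoly_fun q) e) ->
  universal_spectrum (spectrum rho l N_lt).
Proof.
move=> rho_le N0 l_good l_lt C0 hl f /cpolymost_lebesgue_measurable cf.
(* [C i] compensates the error of stage [i] when it is truncated, [C i.+1] the residual that it
   hands to the next stage. *)
pose eps i := (1 / 2) ^+ i / (C i + C i.+1 + 1) : R.
have den0 i : 0 < C i + C i.+1 + 1 by have := C0 i; have := C0 i.+1; lra.
have half0 i : 0 < (1 / 2 : R) ^+ i by rewrite exprn_gt0.
have eps0 i : 0 < eps i by rewrite divr_gt0.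
have epsE i : eps i * (C i + C i.+1 + 1) = (1 / 2) ^+ i by rewrite divfK// gt_eqF.
pose P (r : R -> R[i]) i s x := cabs (r x - tsum rho (l s) x) <= eps i /\
  forall A, initial A -> cabs (psum rho (l s) A x) <= C i * cabs (r x) + (C i + 1) * eps i.
(* Stated for arbitrary functions, so that [choice] yields a total [next]; that the residuals are
   [cpolymost] is proved after the recursion. *)
have step (a : (R -> R[i]) * nat * nat) : exists s, (a.2 <= s)%N /\
    (cpolymost a.1.1 -> mostly a.1.2%:R (1 / (2 ^ a.1.2.+1)%:R) (P a.1.1 a.1.2 s)).
  case: a => [[r i] S] /=; have [cr|ncr] := pselect (cpolymost r); last by exists S.
  have d0 : 0 < 1 / (2 ^ i.+1)%:R :> R by rewrite divr_gt0// ltr0n expn_gt0.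
  by have [s Ss hs] := greedy_step S (C0 i) d0 (eps0 i) cr (hl i); exists s.
have [next hnext] := choice step.
(* The state holds the residual and a lower bound for the next stage, which keeps [sel]
   increasing. *)
pose st := fix st i : (R -> R[i]) * nat := if i is j.+1 then
  let s := next ((st j).1, j, (st j).2) in (fun x => (st j).1 x - tsum rho (l s) x, s.+1)
  else (f, 0%N).
pose r i := (st i).1; pose sel i := next (r i, i, (st i).2).
have rS i x : r i.+1 x = r i x - tsum rho (l (sel i)) x by [].
have sel_lt i : (sel i < sel i.+1)%N by have [h _] := hnext (r i.+1, i.+1, (st i.+1).2).
have cr i : cpolymost (r i).
  elim: i => [//|i IH]; have := cpolymostD IH (cpolymostZ (-1) (cpolymost_tsum rho (l (sel i)))).
  by congr cpolymost; apply/funext => x; rewrite mulN1r.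
have rE i x : r i x = f x - \sum_(j < i) tsum rho (l (sel j)) x.
  elim: i => [|i IH]; first by rewrite big_ord0 subr0.
  by rewrite rS IH big_ord_recr /= opprD addrA.
have good_i i : mostly i%:R (1 / (2 ^ i.+1)%:R) (P (r i) i (sel i)).
  by have [_ h] := hnext (r i, i, (st i).2); exact: h (cr i).
exists (coef l N_lt sel).
apply: negligibleS (borel_cantelli_mostly good_i) => x /=; apply: contra_not => -[n0 hx].
(* A positive element of [R[i]] has imaginary part 0. *)
apply/cvgrPdist_le => -[e b]; rewrite ltcE /= => /andP[/eqP -> e0].
have [|n1 hn1] := @geometric_small R (1 / 2) (e / 3) ltac:(lra); first by rewrite divr_gt0.
pose n := maxn n0 n1.
exists (Num.max 0 (N (sel n).+1)%:R); split; first exact: num_real.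
move=> eta; rewrite gt_max => /andP[eta0 /ltW etaN].
have [j [A [iA jP ->]]] :=
  symm_partial_sum_split rho_le N0 N_lt l_good l_lt sel_lt x eta0.
(* After the shift [j.+1] stages are complete: stage [j] bounds the residual and stage [j.+1] is the
   truncated one. *)
have {jP} := jP n etaN; case: j iA => // j iA; rewrite ltnS => nj.
have n0j : (n0 <= j)%N by apply: leq_trans nj; exact: leq_maxl.
have [hr _] := hx j n0j; have [_ /(_ A iA) hp] := hx j.+1 (leqW n0j).
rewrite -rS in hr.
rewrite opprD addrA -rE.
suff h : cabs (r j.+1 x - psum rho (l (sel j.+1)) A x) <= e.
  by move: h; rewrite -lecR -cabsE.
apply: le_trans (cabsB _ _) _.
have ej : (1 / 2) ^+ j <= e / 3.
  apply: le_trans hn1; apply: ler_wiXn2l; [lra|lra|].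
  by apply: leq_trans nj; exact: leq_maxr.
(* The error is at most [(C j.+1 + 1) * (eps j + eps j.+1)], hence at most
   [3 / 2 * (1 / 2) ^+ j]. *)
have := epsE j; have := epsE j.+1; rewrite exprS.
have h1 : C j.+1 * cabs (r j.+1 x) <= C j.+1 * eps j by rewrite ler_wpM2l.
have h2 : 0 <= eps j * C j by rewrite mulr_ge0// ltW.
have h3 : 0 <= eps j.+1 * C j.+2 by rewrite mulr_ge0// ltW.
have h4 := eps0 j; have h5 := eps0 j.+1.
have h6 : 0 <= eps j * C j.+1 by rewrite mulr_ge0// ltW.
lra.
Qed.

Lemma universal_perturbed_spectrum (rho : nat -> R) : (forall k, rho k != 0) ->
  rho @ \oo --> (0 : R) ->
  exists lam : int -> R, [/\ asymp_int lam, universal_spectrum lam &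
    finite_repetition_rearrangement (fun n => lam n - n%:~R) rho].
Proof.
move=> rho_neq0 rho_cvg.
have [K0 _ rho_le] : exists2 K0 : nat, True & forall k, (K0 <= k)%N -> `|rho k| <= 1 / 4.
  have e4 : 0 < 1 / 4 :> R by lra.
  have /cvgrPdist_le/(_ _ e4)[K0 _ hK] := rho_cvg; exists K0 => // k kK.
  by have := hK k kK; rewrite sub0r normrN.
have [C [N [l [C0 [N0 N_lt] l_good l_lt hl]]]] := spectrum_data rho_neq0 rho_cvg K0.
exists (spectrum rho l N_lt); split.
- exact: (spectrum_asymp_int N0 N_lt l_good rho_cvg).
- exact: (universal_spectrumP N_lt rho_le N0 l_good l_lt C0 hl).
- exists (kappa l N_lt); split.
  + exact: (kappa_surj N0 N_lt l_good l_lt).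
  + exact: (kappa_finite N0 N_lt l_good).
  + by move=> n; rewrite /spectrum addrAC subrr add0r.
Qed.

End UniversalSpectrum.

Theorem mainTheorem1 (R : realType) :
  (exists lam : int -> R, asymp_int lam /\ universal_spectrum lam) /\
  (forall rho : nat -> R,
    (forall k : nat, rho k != 0) -> rho @ \oo --> (0 : R) ->
    exists lam : int -> R,
      [/\ asymp_int lam,
          universal_spectrum lam &
          finite_repetition_rearrangement
            (fun n : int => lam n - n%:~R) rho]).
Proof.
split; last exact: universal_perturbed_spectrum.
(* Any nonvanishing null sequence would do; [harmonic] is one. *)
have [|lam [lamZ lamU _]] :=
    @universal_perturbed_spectrum R harmonic _ (@cvg_harmonic R).
  by move=> k; rewrite invr_eq0 pnatr_eq0.
by exists lam.
Qed.
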